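(* Let $\mu$ be a measure on $\mathbb R_+$ which is both finite and co-finite, and suppose $H=H_\mu\neq0$. Let $h=h_\mu$, and let $\phi_E$, $\theta_E$ and $\Delta(E)$, $E\in\mathbb C\setminus(-\operatorname{spec}(H))$, be as defined in the context. (i) For $E\in\mathbb C\setminus(-\operatorname{spec}(H))$, we have $$(H-E)\phi_E=\Delta(E)h^{\rm int},\qquad (H-E)\theta_E=\Delta(E)h.$$ In particular, if $E>0$ is an eigenvalue of $H$, then both $\phi_E$ and $\theta_E$ are collinear with the corresponding eigenvector. (ii) For $E\in\mathbb C\setminus(-\operatorname{spec}(H))$ not in the spectrum of $H$, the elements $\phi_E$ and $\theta_E$ are linearly independent, unless $\operatorname{rank}H=1$.
   Context: $\mathbb R_+=(0,\infty)$. A (non-negative Borel) measure $\mu$ on $\mathbb R_+$ is finite if $\mu(\mathbb R_+)<\infty$ and co-finite if $\int_0^\infty\lambda^{-2}d\mu(\lambda)<\infty$. Put $h(t)=h_\mu(t)=\int_0^\infty e^{-t\lambda}\,d\mu(\lambda)$, $t>0$, and $(H_\mu f)(t)=\int_0^\infty h_\mu(t+s)f(s)\,ds$ on $L^2(\mathbb R_+)$. When $\mu$ is finite and co-finite, $H=H_\mu$ is a positive semi-definite self-adjoint trace class operator, $0\in\operatorname{spec}(H)$, and both $h$ and $h^{\rm int}(t)=\int_t^\infty h(s)\,ds=\int_0^\infty e^{-t\lambda}\lambda^{-1}d\mu(\lambda)$ belong to $L^2(\mathbb R_+)$. For $E\in\mathbb C\setminus(-\operatorname{spec}(H))$ define functions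 on $\mathbb R_+$ $$\phi_E(t)=-\int_t^\infty\phi_E'(s)\,ds,\quad \phi_E'=(H+E)^{-1}h,\qquad \theta_E(t)=\frac{d}{dt}\bigl((H+E)^{-1}h^{\rm int}\bigr)(t),$$ which are in $L^2(\mathbb R_+)$, and $$\Delta(E)=1+\frac1E\Bigl(-\langle h\rangle+\langle(H+E)^{-1}h,h^{\rm int}\rangle\Bigr),\qquad \langle h\rangle=\int_0^\infty h(t)\,dt,$$ where $\langle\cdot,\cdot\rangle$ is the inner product of $L^2(\mathbb R_+)$, linear in the first argument. (Equivalently $\Delta(E)=\det(I-\tfrac1EH)/\det(I+\tfrac1EH)$.) *)

(* Defs.v *)
From mathcomp Require Import all_boot all_order all_algebra.
From mathcomp Require Import all_classical all_reals all_analysis.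
From mathcomp.real_closed Require Export complex.

Set Implicit Arguments.
Unset Strict Implicit.
Unset Printing Implicit Defensive.
Import Order.TTheory GRing.Theory Num.Theory.
Import numFieldNormedType.Exports.

Local Open Scope classical_set_scope.
Local Open Scope ring_scope.
Local Open Scope complex_scope.

(* Elements of the complex Hilbert space L^2(R_+) are represented by functions
   f : R -> R[i], of which only the values on R_+ = ]0, +oo[ matter, up to
   almost-everywhere equality on R_+ (aeq).  Operators act on representatives. *)

Definition Rpos {R : realType} : set R := `]0, +oo[.

(* R[i] has no Lebesgue integral or derivative over R in the library: both are
   taken componentwise. *)
Definition cintegral {R : realType} (D : set R) (f : R -> R[i]) : R[i] :=
  (\int[lebesgue_measure]_(t in D) complex.Re (f t)) +i*
  (\int[lebesgue_measure]_(t in D) complex.Im (f t)).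

Definition cderivable {R : realType} (f : R -> R[i]) (t : R) : Prop :=
  derivable (@complex.Re R \o f) t 1 /\ derivable (@complex.Im R \o f) t 1.

Definition cderive {R : realType} (f : R -> R[i]) (t : R) : R[i] :=
  derive1 (@complex.Re R \o f) t +i* derive1 (@complex.Im R \o f) t.

Definition aeq {R : realType} (f g : R -> R[i]) : Prop :=
  f = g %[ae lebesgue_measure in Rpos].

Definition L2 {R : realType} (f : R -> R[i]) : Prop :=
  (@complex.Re R \o f) \_ Rpos \in Lfun lebesgue_measure 2%:E /\
  (@complex.Im R \o f) \_ Rpos \in Lfun lebesgue_measure 2%:E.

Definition L2norm {R : realType} (f : R -> R[i]) : \bar R :=
  'N[lebesgue_measure]_2%:E[EFin \o ((@Normc.normc R \o f) \_ Rpos)].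

Definition L2inner {R : realType} (f g : R -> R[i]) : R[i] :=
  cintegral Rpos (fun t => f t * (g t)^*).

Definition operator (R : realType) := (R -> R[i]) -> R -> R[i].

(* add_scalar T z = T + z I *)
Definition add_scalar {R : realType} (T : operator R) (z : R[i]) : operator R :=
  fun f t => T f t + z * f t.

Definition boundedly_invertible {R : realType} (T : operator R) : Prop :=
  (forall f, L2 f -> aeq (T f) (cst 0) -> aeq f (cst 0)) /\
  (exists C : R, forall g, L2 g ->
     exists f, [/\ L2 f, aeq (T f) g & (L2norm f <= C%:E * L2norm g)%E]).

Definition spectrum {R : realType} (T : operator R) : set R[i] :=
  [set z | ~ boundedly_invertible (add_scalar T (- z))].

(* A representative of T^-1 g (unique up to aeq when T is injective on L^2). *)
Definition op_inv {R : realType} (T : operator R) (g : R -> R[i]) : R -> R[i] :=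
  xget (cst 0) [set f | L2 f /\ aeq (T f) g].

Definition eigenvector {R : realType} (T : operator R) (z : R[i])
    (psi : R -> R[i]) : Prop :=
  [/\ L2 psi, ~ aeq psi (cst 0) & aeq (T psi) (fun t => z * psi t)].

Definition lin_indep {R : realType} (n : nat) (e : 'I_n -> R -> R[i]) : Prop :=
  forall c : 'I_n -> R[i],
    aeq (fun t => \sum_(i < n) c i * e i t) (cst 0) -> forall i, c i = 0.

(* The range of T has dimension n, with basis T (e 0), ..., T (e n.-1). *)
Definition has_rank {R : realType} (T : operator R) (n : nat) : Prop :=
  exists e : 'I_n -> R -> R[i],
    [/\ forall i, L2 (e i),
        lin_indep (fun i => T (e i)) &
        forall f, L2 f -> exists c : 'I_n -> R[i],
          aeq (T f) (fun t => \sum_(i < n) c i * T (e i) t)].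

(* The representative of u that is differentiable on R_+, if there is one; its
   values on R_+ are then determined by the class of u. *)
Definition diff_repr {R : realType} (u : R -> R[i]) : R -> R[i] :=
  xget u [set v | aeq v u /\ forall t, 0 < t -> cderivable v t].

(* A Borel measure on R_+ is given as a Borel measure on R of which only the
   restriction to R_+ is ever used. *)
Notation borel_measure R := {measure set (measurableTypeR R) -> \bar R}.

Definition finite_on_Rpos {R : realType} (mu : borel_measure R) : Prop :=
  (mu Rpos < +oo)%E.

Definition cofinite_on_Rpos {R : realType} (mu : borel_measure R) : Prop :=
  (\int[mu]_(l in Rpos) (l ^- 2)%:E < +oo)%E.

Definition hmu {R : realType} (mu : borel_measure R) (t : R) : R :=
  \int[mu]_(l in Rpos) expR (- (t * l)).

Definition hmu_int {R : realType} (mu : borel_measure R) (t : R) : R :=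
  \int[lebesgue_measure]_(s in `]t, +oo[) hmu mu s.

Definition hmuC {R : realType} (mu : borel_measure R) (t : R) : R[i] :=
  (hmu mu t)%:C.

Definition hmu_intC {R : realType} (mu : borel_measure R) (t : R) : R[i] :=
  (hmu_int mu t)%:C.

Definition Hankel {R : realType} (mu : borel_measure R) : operator R :=
  fun f t => cintegral Rpos (fun s => hmuC mu (t + s) * f s).

Definition phi {R : realType} (mu : borel_measure R) (E : R[i]) (t : R) : R[i] :=
  - cintegral `]t, +oo[ (op_inv (add_scalar (Hankel mu) E) (hmuC mu)).

Definition theta {R : realType} (mu : borel_measure R) (E : R[i]) (t : R) :
    R[i] :=
  cderive (diff_repr (op_inv (add_scalar (Hankel mu) E) (hmu_intC mu))) t.

Definition Delta {R : realType} (mu : borel_measure R) (E : R[i]) : R[i] :=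
  1 + E^-1 * (- (\int[lebesgue_measure]_(t in Rpos) hmu mu t)%:C
              + L2inner (op_inv (add_scalar (Hankel mu) E) (hmuC mu)) (hmu_intC mu)).

(* Main.v *)
Require Import Defs.
From mathcomp Require Import all_boot all_order all_algebra.
From mathcomp Require Import all_classical all_reals all_analysis.
From mathcomp Require Import measurable_realfun.
From mathcomp Require Import ring lra zify.
Import Order.TTheory GRing.Theory Num.Theory.
Import numFieldNormedType.Exports.
Local Open Scope classical_set_scope.
Local Open Scope ring_scope.
Local Open Scope complex_scope.

(** The operator factorizes. Write (L a)(t) for the integral of a(k) e^{-tk}
    against mu, and (L' f)(k) for the integral of f(s) e^{-ks} over s > 0. By
    Fubini H = L L', h = L 1 and h^int = L (1/k), and L, L' are adjoint to each
    other ([duality]). Every function of the statement then has the form L a.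
    If (H + E) u = h and (H + E) w = h^int, then u = L a and w = L b with
    E a = 1 - L' u and E b = 1/k - L' w ([resolvent_repr]). Integrating or
    differentiating L a amounts to dividing or multiplying a by k, so that
    phi_E = - L (a/k) and theta_E = - L (k b), without boundary terms.

    The engine is the identity ([laplace_shift])
      L' L (k a) (l) = int a dmu - l (L' L a)(l),
    which is k / (k + l) = 1 - l / (k + l) integrated against a dmu. It says
    that H anticommutes with d/dt up to a rank one term. Applied to a/k and to b
    it gives
      (H - E) phi_E = (1 - int a/k dmu) h^int,
      (H - E) theta_E = (1 - int b dmu) h.
    The first coefficient is Delta(E) by the definition of Delta and duality
    ([Delta_cint]); the two coefficients agree because u and w satisfy
    int w (L a) = int u (L b), both sides being int u w ([cint_symmetry]).
    Here E <> 0: if H were onto, an indicator function would coincide almost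
    everywhere with a differentiable function ([boundedly_invertible_neq0]).

    Let H psi = E psi with E > 0, so that psi = L g with E g = L' psi. The same
    identity, now with nothing in place of the source terms 1 and 1/k, reads
      (H + E) L (k g) = (int g dmu) h,
      (H + E) L (g/k) = (int g/k dmu) h^int.
    Since H is positive, H + E is injective ([add_scalar_pos_injective]), which
    forces both constants to be nonzero. This solves the two resolvent equations
    explicitly and uniquely, and gives phi_E and theta_E as multiples of
    L g = psi. In particular it shows that the eigenvalue is simple.

    For the independence, let c0 phi_E + c1 theta_E = 0 and apply H - E: this
    gives Delta(E) (c0 h^int + c1 h) = 0. Here Delta(E) <> 0, since otherwise
    H - E would annihilate phi_E, hence phi_E = 0 and h = 0
    ([phi_ae0_Delta0]). So L (c0/k + c1) = 0. For real p, q the vanishing of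
    L' L (p/k + q) at 1 and 2 implies that of the integral of the nonnegative
    function (p + q k)^2 / (k (k + 1) (k + 2)), so that mu is a point mass
    unless p = q = 0 ([laplace_affine_eq0]); and for a point mass the rank of H
    is one.

    All convergence questions are settled by one weight: 1 + k^-2 is
    mu-integrable because mu is finite and co-finite, and the amplitudes a that
    occur are bounded by multiples of sqrt(k)^n (1 + k^-2) ([growth]). *)

Set Implicit Arguments.
Unset Strict Implicit.
Unset Printing Implicit Defensive.

(** * Fubini for a kernel pairing *)

Section kernel_duality.
Context d1 d2 {T1 : measurableType d1} {T2 : measurableType d2} {R : realType}.
Variables (m1 : {sigma_finite_measure set T1 -> \bar R})
          (m2 : {sigma_finite_measure set T2 -> \bar R}).
Variables (D1 : set T1) (D2 : set T2) (K : T1 * T2 -> R).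
Variables (f : T1 -> R) (a : T2 -> R).
Hypotheses (mD1 : measurable D1) (mD2 : measurable D2).
Hypothesis mK : measurable_fun setT K.
Hypothesis K_ge0 : forall z, 0 <= K z.
Hypotheses (mf : measurable_fun D1 f) (ma : measurable_fun D2 a).
Hypothesis intf : forall y, D2 y ->
  m1.-integrable D1 (EFin \o (fun x => f x * K (x, y))).
Hypothesis inta : forall x, D1 x ->
  m2.-integrable D2 (EFin \o (fun y => a y * K (x, y))).
Variable G : T2 -> R.
Hypothesis intG : m2.-integrable D2 (EFin \o G).
Hypothesis le_G : forall y, D2 y ->
  `|a y| * \int[m1]_(x in D1) (`|f x| * K (x, y)) <= G y.

Let F (z : T1 * T2) : \bar R :=
  ((f \_ D1) z.1 * (a \_ D2) z.2 * K z)%:E.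

Let measurable_F : measurable_fun setT F.
Proof.
apply/measurable_EFinP; apply: measurable_funM => //; apply: measurable_funM.
- apply: (@measurableT_comp _ _ _ _ _ _ (f \_ D1)); last exact: measurable_fst.
  by apply/(measurable_restrictT _ mD1).
- apply: (@measurableT_comp _ _ _ _ _ _ (a \_ D2)); last exact: measurable_snd.
  by apply/(measurable_restrictT _ mD2).
Qed.

Let slice1 y (c : R) (g : T1 -> R) : D2 y ->
  m1.-integrable D1 (EFin \o (fun x => g x * K (x, y))) ->
  (\int[m1]_x (c * ((g \_ D1) x * K (x, y)))%:E =
  (c * \int[m1]_(x in D1) (g x * K (x, y)))%:E)%E.
Proof.
move=> Dy ig; rewrite EFinM /Rintegral fineK; last exact: integrable_fin_num.
rewrite -integralZl// [RHS]integral_mkcond; apply: eq_integral => x _.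
by rewrite /= !patchE; case: ifPn => _ /=; rewrite ?mul0r ?mulr0 ?EFinM.
Qed.

Let int_absf y : D2 y ->
  m1.-integrable D1 (EFin \o (fun x => `|f x| * K (x, y))).
Proof.
move=> Dy; have := integrable_norm (intf Dy).
apply: eq_integrable => // x _ /=; congr EFin.
by rewrite normrM (ger0_norm (K_ge0 _)).
Qed.

Let inner1 y : (\int[m1]_x F (x, y))%E =
  ((EFin \o (fun y => a y * \int[m1]_(x in D1) (f x * K (x, y)))) \_ D2) y.
Proof.
rewrite patchE; case: ifPn => [/set_mem Dy|Dy]; last first.
  rewrite integral0_eq// => x _; rewrite /F /= [X in _ * X * _]patchE.
  by rewrite (negbTE Dy) mulr0 mul0r.
rewrite /= -slice1//; last exact: intf.
apply: eq_integral => x _; rewrite /F /= [X in _ * X * _]patchE mem_set//.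
by congr EFin; rewrite [X in _ = X]mulrA (mulrC (a y)).
Qed.

Let inner1_abs y : (\int[m1]_x `|F (x, y)|)%E =
  ((EFin \o (fun y => `|a y| * \int[m1]_(x in D1) (`|f x| * K (x, y)))) \_ D2) y.
Proof.
rewrite patchE; case: ifPn => [/set_mem Dy|Dy]; last first.
  rewrite integral0_eq// => x _; rewrite /F /= [X in _ * X * _]patchE.
  by rewrite (negbTE Dy) mulr0 mul0r normr0.
rewrite /= -slice1//; last exact: int_absf.
apply: eq_integral => x _; rewrite /F /= [X in _ * X * _]patchE mem_set//.
rewrite !normrM (ger0_norm (K_ge0 _)) [X in _ = X%:E]mulrA (mulrC `|a y|).
by rewrite !patchE; case: ifPn; rewrite ?normr0.
Qed.

Let inner2 x : (\int[m2]_y F (x, y))%E =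
  ((EFin \o (fun x => f x * \int[m2]_(y in D2) (a y * K (x, y)))) \_ D1) x.
Proof.
rewrite patchE; case: ifPn => [/set_mem Dx|Dx]; last first.
  rewrite integral0_eq// => y _; rewrite /F /= [X in X * _ * _]patchE.
  by rewrite (negbTE Dx) !mul0r.
rewrite /= EFinM /Rintegral fineK; last by apply: integrable_fin_num => //; exact: inta.
rewrite -integralZl//; last exact: inta.
rewrite [RHS]integral_mkcond; apply: eq_integral => y _.
rewrite /F /= !patchE mem_set//.
by case: ifPn => _; rewrite ?mulr0 ?mul0r// -EFinM mulrA.
Qed.

Let integrable_F : (m1 \x m2)%E.-integrable setT F.
Proof.
apply/integrable21ltyP => //.
have FE : (fun y => \int[m1]_x `|F (x, y)|)%E = _ := funext inner1_abs.
have mF : measurable_fun setT (fun y => \int[m1]_x `|F (x, y)|)%E.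
  apply: (measurable_fun_fubini_tonelli_G (abse \o F)) => //=.
  exact: measurableT_comp.
rewrite FE in mF *; have [mG Gfin] := integrableP _ _ _ intG.
rewrite -[X in (X < _)%E]integral_mkcond; apply: le_lt_trans Gfin.
apply: ge0_le_integral => //=.
- move=> y _; rewrite lee_fin mulr_ge0//; apply: Rintegral_ge0 => x _.
  by rewrite mulr_ge0.
- by apply/(measurable_restrictT _ mD2).
- by apply/measurable_EFinP; apply: measurableT_comp => //; exact/measurable_EFinP.
- by move=> y Dy; rewrite lee_fin (le_trans (le_G Dy))// ler_norm.
Qed.

(** The majorant [G] bounds the iterated integral of the absolute values, so
    Tonelli gives integrability on the product and Fubini applies. A majorant is
    used, and not finiteness of the iterated integral, so that no measurability
    of the inner integral has to be known beforehand. *)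
Lemma kernel_duality :
  [/\ m1.-integrable D1 (EFin \o (fun x => f x * \int[m2]_(y in D2) (a y * K (x, y)))),
      m2.-integrable D2 (EFin \o (fun y => a y * \int[m1]_(x in D1) (f x * K (x, y)))) &
      \int[m1]_(x in D1) (f x * \int[m2]_(y in D2) (a y * K (x, y))) =
      \int[m2]_(y in D2) (a y * \int[m1]_(x in D1) (f x * K (x, y)))].
Proof.
have FE : (fun x => \int[m2]_y F (x, y))%E = _ := funext inner2.
have GE : (fun y => \int[m1]_x F (x, y))%E = _ := funext inner1.
split.
- by apply/(integrable_mkcond _ mD1); rewrite -FE; exact: integrable_fubini_F.
- apply/(integrable_mkcond _ mD2); rewrite -GE; apply/integrableP; split.
    exact: (measurable_fubini_G integrable_F).
  apply: le_lt_trans ((integrable21ltyP m1 m2 measurable_F).1 integrable_F).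
  apply: ge0_le_integral => //.
  + by apply: measurableT_comp => //; exact: (measurable_fubini_G integrable_F).
  + apply: (measurable_fun_fubini_tonelli_G (abse \o F)) => //=.
    exact: measurableT_comp.
  + move=> y _; apply: le_abse_integral => //.
    by apply: measurableT_comp => //; exact: measurable_pair2.
- rewrite /Rintegral [in LHS]integral_mkcond [in RHS]integral_mkcond; congr fine.
  by rewrite -FE -GE; exact: Fubini.
Qed.

End kernel_duality.

(** * Laplace transforms against a measure *)

Lemma measurable_Rpos {R : realType} :
  measurable (Rpos : set (measurableTypeR R)).
Proof. exact: measurable_itv. Qed.

#[local] Hint Resolve measurable_Rpos : core.

Lemma RposE {R : realType} (x : R) : Rpos x = (0 < x).
Proof. by rewrite /Rpos /= in_itv /= andbT. Qed.

(** The measure is a parameter so that the transform in the spectral variable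
    (against mu) and the one in the time variable (against Lebesgue measure) are
    one notion, with a symmetric duality. *)
Definition laplace {R : realType} (m : borel_measure R) (f : R -> R) (x : R) : R :=
  \int[m]_(y in Rpos) (f y * expR (- (x * y))).

Lemma eq_laplace {R : realType} (m : borel_measure R) (a b : R -> R) :
  (forall k, 0 < k -> a k = b k) -> laplace m a =1 laplace m b.
Proof.
by move=> ab t; apply: eq_Rintegral => k /set_mem; rewrite RposE => /ab ->.
Qed.

Lemma le_laplace_norm {R : realType} (m : borel_measure R) (f : R -> R) x :
  m.-integrable Rpos (EFin \o (fun y => f y * expR (- (x * y)))) ->
  `|laplace m f x| <= laplace m (fun y => `|f y|) x.
Proof.
move=> fx; rewrite (le_trans (le_normr_Rintegral _ fx))//.
rewrite le_eqVlt; apply/orP; left; apply/eqP; apply: eq_Rintegral => y _.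
by rewrite normrM (ger0_norm (expR_ge0 _)).
Qed.

Lemma measurable_expRM {R : realType} (c : R) (D : set (measurableTypeR R)) :
  measurable_fun D (fun s : measurableTypeR R => expR (- (c * s))).
Proof.
by apply: measurableT_comp => //; apply: measurableT_comp.
Qed.

Lemma laplace_duality {R : realType}
    (m1 m2 : {sigma_finite_measure set (measurableTypeR R) -> \bar R})
    (f a G : R -> R) :
    measurable_fun (Rpos : set (measurableTypeR R)) f ->
    measurable_fun (Rpos : set (measurableTypeR R)) a ->
    (forall k, 0 < k ->
      m1.-integrable Rpos (EFin \o (fun s => f s * expR (- (k * s))))) ->
    (forall s, 0 < s ->
      m2.-integrable Rpos (EFin \o (fun k => a k * expR (- (s * k))))) ->
    m2.-integrable Rpos (EFin \o G) ->
    (forall k, 0 < k -> `|a k| * laplace m1 (fun s => `|f s|) k <= G k) ->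
  [/\ m1.-integrable Rpos (EFin \o (fun s => f s * laplace m2 a s)),
      m2.-integrable Rpos (EFin \o (fun k => a k * laplace m1 f k)) &
      \int[m1]_(s in Rpos) (f s * laplace m2 a s) =
      \int[m2]_(k in Rpos) (a k * laplace m1 f k)].
Proof.
move=> mf ma intf inta intG le_G.
pose K (z : measurableTypeR R * measurableTypeR R) := expR (- (z.1 * z.2)) : R.
have KC (g : R -> R) (k : R) : (fun s => g s * K (s, k)) =
    (fun s => g s * expR (- (k * s))).
  by apply/funext => s; rewrite /K /= (mulrC s).
have LK (g : R -> R) (k : R) :
    \int[m1]_(s in Rpos) (g s * K (s, k)) = laplace m1 g k.
  by rewrite KC.
have mK : measurable_fun setT K.
  rewrite /K; apply: measurableT_comp => //; apply: measurableT_comp => //.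
  exact: measurable_funM.
have intf' (k : R) : Rpos k ->
    m1.-integrable Rpos (EFin \o (fun s => f s * K (s, k))).
  by rewrite RposE KC; exact: intf.
have inta' (s : R) : Rpos s ->
    m2.-integrable Rpos (EFin \o (fun k => a k * K (s, k))).
  by rewrite RposE; exact: inta.
have le_G' k : Rpos k ->
    `|a k| * \int[m1]_(s in Rpos) (`|f s| * K (s, k)) <= G k.
  by rewrite RposE LK; exact: le_G.
have K0 z : 0 <= K z by exact: expR_ge0.
have [h1 h2 h3] := kernel_duality measurable_Rpos measurable_Rpos mK K0
  mf ma intf' inta' intG le_G'.
split.
- exact: h1.
- by under [X in _ \o X]eq_fun => k do rewrite -LK; exact: h2.
- by under [RHS]eq_Rintegral => k _ do rewrite -LK; exact: h3.
Qed.

Section exponentials.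
Context {R : realType}.
Local Notation leb := (@lebesgue_measure R).

Lemma integral_expR_gt (t k : R) : 0 < k ->
  (\int[leb]_(s in `]t, +oo[) (expR (- (k * s)))%:E =
   (expR (- (k * t)) / k)%:E)%E.
Proof.
move=> k0; rewrite integral_itv_obnd_cbnd; last first.
  by apply/measurable_EFinP; exact: measurable_expRM.
have cexp : continuous (fun s : R => expR (- (k * s)) : R).
  move=> x; apply: continuous_comp; last exact: continuous_expR.
  by apply: continuousN; apply: continuousM; [exact: cst_continuous|].
rewrite (@ge0_continuous_FTC2y R _ (fun s => - (expR (- (k * s)) / k)) t 0).
- by rewrite sub0e EFinN oppeK.
- by move=> x _; exact: expR_ge0.
- exact: continuous_subspaceT.
- rewrite -oppr0; apply: cvgN; rewrite -(mul0r k^-1); apply: cvgMl.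
  rewrite (_ : (fun x => _) = (fun z => expR (- z)) \o (fun z => k * z))//.
  apply: (@cvg_comp _ _ _ _ _ _ (pinfty_nbhs R)); last exact: cvgr_expR.
  exact: gt0_cvgMry.
- by move=> x _; exact: ex_derive.
- apply: cvg_at_right_filter; apply: cvgN; apply: cvgMl; exact: cexp.
- move=> x _; rewrite derive1E derive_val.
  by rewrite /GRing.scale/=; field; rewrite gt_eqF.
Qed.

Lemma integrable_expR_gt (t k : R) : 0 < k ->
  leb.-integrable `]t, +oo[ (EFin \o (fun s => expR (- (k * s)))).
Proof.
move=> k0; apply/integrableP; split.
  by apply/measurable_EFinP; exact: measurable_expRM.
under eq_integral => x _ do rewrite /= ger0_norm ?expR_ge0//.
by rewrite integral_expR_gt// ltry.
Qed.

Lemma Rintegral_expR_gt (t k : R) : 0 < k ->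
  \int[leb]_(s in `]t, +oo[) expR (- (k * s)) = expR (- (k * t)) / k.
Proof. by move=> k0; rewrite /Rintegral integral_expR_gt. Qed.

End exponentials.

(** * Growth classes of amplitudes *)

(** The weight 1 + k^-2 is integrable against a finite and co-finite measure.
    The extra factor is a power of sqrt(k) because the transform of a square
    integrable function is of order k^(-1/2). In terms of r = sqrt(k), class [n]
    contains the powers of r with exponents from n - 4 to n. Class 0 is
    mu-integrable, class 1 has a square integrable transform, and class 2 has a
    transform that is integrable up to 0. *)
Definition growth {R : realType} (n : int) (a : R -> R) : Prop :=
  measurable_fun (Rpos : set (measurableTypeR R)) a /\
  exists C, forall k, 0 < k -> `|a k| <= C * (Num.sqrt k ^ n * (1 + k ^- 2)).

Section growth.
Context {R : realType}.
Implicit Types (a b : R -> R) (n m : int).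

Lemma sqrtz_gt0 (k : R) n : 0 < k -> 0 < Num.sqrt k ^ n.
Proof. by move=> k0; rewrite exprz_gt0// sqrtr_gt0. Qed.

Lemma weight_gt0 (k : R) n : 0 < k -> 0 < Num.sqrt k ^ n * (1 + k ^- 2).
Proof.
by move=> k0; rewrite mulr_gt0 ?sqrtz_gt0// addr_gt0// invr_gt0 exprn_gt0.
Qed.

Lemma sqrtzD (k : R) m n : 0 < k ->
  Num.sqrt k ^ (m + n) = Num.sqrt k ^ m * Num.sqrt k ^ n.
Proof. by move=> k0; rewrite exprzDr// unitfE gt_eqF// sqrtr_gt0. Qed.

Lemma sqrtz2 (k : R) : 0 < k -> Num.sqrt k ^ 2 = k.
Proof. by move=> k0; rewrite -exprnP sqr_sqrtr// ltW. Qed.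

Lemma growthD n a b : growth n a -> growth n b ->
  growth n (fun k => a k + b k).
Proof.
move=> [ma [C hC]] [mb [D hD]]; split; first exact: measurable_funD.
exists (C + D) => k k0; rewrite mulrDl (le_trans (ler_normD _ _))//.
by rewrite lerD ?hC ?hD.
Qed.

Lemma growthZ n c a : growth n a -> growth n (fun k => c * a k).
Proof.
move=> [ma [C hC]]; split; first exact: measurable_funM.
by exists (`|c| * C) => k k0; rewrite normrM -mulrA ler_wpM2l ?hC.
Qed.

Lemma growth_norm n a : growth n a -> growth n (fun k => `|a k|).
Proof.
move=> [ma [C hC]]; split; first exact: measurableT_comp.
by exists C => k k0; rewrite normr_id hC.
Qed.

Lemma growth_mul n a : growth n a -> growth (n + 2) (fun k => k * a k).
Proof.
move=> [ma [C hC]]; split; first exact: measurable_funM.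
exists C => k k0; rewrite sqrtzD// sqrtz2// normrM gtr0_norm//.
rewrite (_ : C * _ = k * (C * (Num.sqrt k ^ n * (1 + k ^- 2)))); last by ring.
by rewrite ler_wpM2l ?hC// ltW.
Qed.

Lemma measurable_inv_Rpos :
  measurable_fun (Rpos : set (measurableTypeR R)) (fun k : R => k^-1).
Proof.
have mV : measurable_fun (Rpos : set R) (fun k : R => k^-1).
  apply: open_continuous_measurable_fun; first exact: interval_open.
  move=> k /set_mem; rewrite RposE => k0.
  by apply: inv_continuous; rewrite gt_eqF.
exact: mV.
Qed.

Lemma growth_div n a : growth (n + 2) a -> growth n (fun k => k^-1 * a k).
Proof.
move=> [ma [C hC]]; split.
  by apply: measurable_funM => //; exact: measurable_inv_Rpos.
exists C => k k0; rewrite normrM ger0_norm ?invr_ge0 ?(ltW k0)//.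
rewrite mulrC ler_pdivrMr// (le_trans (hC _ k0))//.
rewrite sqrtzD// sqrtz2// le_eqVlt; apply/orP; left; apply/eqP; ring.
Qed.

(** For exponents in this range r^(m - n) is at most 1 when r >= 1, and at most
    r^-4 = k^-2 when r <= 1. *)
Lemma growth_pow m n a :
  measurable_fun (Rpos : set (measurableTypeR R)) a ->
  (exists C, forall k, 0 < k -> `|a k| <= C * Num.sqrt k ^ m) ->
  n - 4 <= m -> m <= n -> growth n a.
Proof.
move=> ma [C hC] nm mn; split=> //; exists C => k k0.
have C0 : 0 <= C.
  by have := le_trans (normr_ge0 _) (hC _ k0); rewrite pmulr_lge0// sqrtz_gt0.
rewrite (le_trans (hC _ k0))// ler_wpM2l//.
have r0 : 0 < Num.sqrt k by rewrite sqrtr_gt0.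
have rm : Num.sqrt k ^ m = Num.sqrt k ^ n * Num.sqrt k ^ (m - n).
  by rewrite -sqrtzD//; congr (_ ^ _); ring.
rewrite rm ler_wpM2l ?(ltW (sqrtz_gt0 _ _))//.
have r4 : k ^- 2 = Num.sqrt k ^ (- 4%:Z).
  by rewrite -[in LHS](sqr_sqrtr (ltW k0)) -exprM.
have [r1|r1] := leP (Num.sqrt k) 1.
  rewrite (@le_trans _ _ (Num.sqrt k ^ (- 4%:Z)))//.
    rewrite -exprz_inv -(opprB n m) -exprz_inv; apply: ler_weXz2l; last by lia.
    by rewrite invf_ge1.
  by rewrite -r4 lerDr.
rewrite (@le_trans _ _ (Num.sqrt k ^ 0%:Z))//.
  by apply: ler_weXz2l; [exact: ltW|lia].
by rewrite expr0z lerDl r4 ltW// sqrtz_gt0.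
Qed.

Lemma growth_cst n (c : R) : 0 <= n -> n <= 4 -> growth n (cst c).
Proof.
move=> n0 n4; apply: (@growth_pow 0) => //; last by lia.
by exists `|c| => k k0; rewrite expr0z mulr1.
Qed.

End growth.

(** * Duality between the two transforms *)

Section finite_cofinite.
Context {R : realType}.
Variable mu : {finite_measure set (measurableTypeR R) -> \bar R}.
Hypothesis mu_cofinite : cofinite_on_Rpos mu.
Local Notation leb := (@lebesgue_measure R).
Implicit Types (a b f : R -> R).

Lemma integrable_weight : mu.-integrable Rpos (EFin \o (fun k => 1 + k ^- 2)).
Proof.
have mV : measurable_fun (Rpos : set (measurableTypeR R)) (fun k : R => k ^- 2).
  by under eq_fun do rewrite -exprVn; apply: measurable_funX; exact: measurable_inv_Rpos.
have h1 : mu.-integrable Rpos (EFin \o cst (1 : R)).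
  exact: finite_measure_integrable_cst.
have h2 : mu.-integrable Rpos (EFin \o (fun k : R => k ^- 2)).
  apply/integrableP; split; first exact/measurable_EFinP.
  apply: le_lt_trans mu_cofinite; rewrite le_eqVlt; apply/orP; left; apply/eqP.
  apply: eq_integral => k /set_mem; rewrite RposE => k0 /=.
  by rewrite ger0_norm// invr_ge0 exprn_ge0// ltW.
exact: (integrableD measurable_Rpos h1 h2).
Qed.

Lemma growth0_integrable a : growth 0 a -> mu.-integrable Rpos (EFin \o a).
Proof.
move=> [ma [C hC]].
have h : mu.-integrable Rpos (EFin \o (fun k : R => C * (1 + k ^- 2))).
  exact: (integrableZl measurable_Rpos C integrable_weight).
apply: (le_integrable measurable_Rpos _ _ h); first exact/measurable_EFinP.
move=> k; rewrite RposE => k0 /=; rewrite lee_fin.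
by rewrite (le_trans (hC _ k0))// expr0z mul1r ler_norm.
Qed.

Lemma sqrt_expR_bound (t k : R) : 0 < t -> 0 < k ->
  Num.sqrt k * expR (- (t * k)) <= 1 + t^-1.
Proof.
move=> t0 k0.
have h1 : Num.sqrt k <= 1 + k.
  have s0 := sqrtr_ge0 k; have := sqr_sqrtr (ltW k0).
  by move: (Num.sqrt k) s0 => s s0 <-; nra.
have h2 : expR (- (t * k)) <= 1 by rewrite expR_le1 oppr_le0 mulr_ge0// ltW.
have h3 : k * expR (- (t * k)) <= t^-1.
  rewrite -[leRHS]mul1r ler_pdivlMr// expRN mulrAC ler_pdivrMr ?expR_gt0//.
  by rewrite mul1r (le_trans _ (expR_ge1Dx _))// mulrC lerDr.
have e0 := expR_ge0 (- (t * k)).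
rewrite (le_trans (ler_wpM2r e0 h1))// mulrDl mul1r lerD//.
Qed.

Lemma growth_expR a (t : R) : 0 < t -> growth 1 a ->
  growth 0 (fun k => a k * expR (- (t * k))).
Proof.
move=> t0 [ma [C hC]]; split.
  by apply: measurable_funM => //; exact: measurable_expRM.
exists (C * (1 + t^-1)) => k k0.
rewrite normrM (ger0_norm (expR_ge0 _)) expr0z mul1r.
have := hC k k0; rewrite expr1z => h.
rewrite (le_trans (ler_wpM2r (expR_ge0 _) h))//.
have C0 : 0 <= C.
  by have := le_trans (normr_ge0 _) (hC _ k0); rewrite pmulr_lge0// weight_gt0.
rewrite [leLHS](_ : _ = (C * (1 + k ^- 2)) * (Num.sqrt k * expR (- (t * k)))); last by ring.
rewrite [leRHS](_ : _ = (C * (1 + k ^- 2)) * (1 + t^-1)); last by ring.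
rewrite ler_wpM2l ?sqrt_expR_bound// mulr_ge0// addr_ge0// invr_ge0 exprn_ge0//.
exact: ltW.
Qed.

Lemma growth1_laplace_integrable a t : 0 < t -> growth 1 a ->
  mu.-integrable Rpos (EFin \o (fun k => a k * expR (- (t * k)))).
Proof. by move=> t0 ga; apply: growth0_integrable; exact: growth_expR. Qed.

(** The exponent records the size of the transform of |f| as a power of sqrt(k):
    -1 for square integrable functions and -2 for bounded ones. It selects the
    growth class of the amplitudes that can be paired with f. *)
Definition transformable (m : int) f : Prop :=
  [/\ measurable_fun (Rpos : set (measurableTypeR R)) f,
      forall k, 0 < k -> leb.-integrable Rpos (EFin \o (fun s => f s * expR (- (k * s)))) &
      exists C, forall k, 0 < k -> laplace leb (fun s => `|f s|) k <= C * Num.sqrt k ^ m].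

Lemma duality m f a : transformable m f -> growth 1 a -> growth (- m) a ->
  [/\ leb.-integrable Rpos (EFin \o (fun s => f s * laplace mu a s)),
      mu.-integrable Rpos (EFin \o (fun k => a k * laplace leb f k)) &
      \int[leb]_(s in Rpos) (f s * laplace mu a s) =
      \int[mu]_(k in Rpos) (a k * laplace leb f k)].
Proof.
move=> [mf intf [D hD]] ga [ma [C hC]].
have D0 : 0 <= D.
  have := hD 1 ltr01; rewrite sqrtr1 exp1rz mulr1; apply: le_trans.
  by apply: Rintegral_ge0 => s _; rewrite mulr_ge0 ?expR_ge0.
apply: (@laplace_duality _ _ _ _ _ (fun k => (C * D) * (1 + k ^- 2))) => //.
- by move=> s s0; exact: growth1_laplace_integrable.
- exact: (integrableZl measurable_Rpos (C * D) integrable_weight).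
- move=> k k0; have h1 := hC k k0; have h2 := hD k k0.
  rewrite (le_trans (ler_wpM2l (normr_ge0 _) h2))//.
  rewrite (le_trans (ler_wpM2r _ h1))//.
    by rewrite mulr_ge0// ltW// sqrtz_gt0.
  rewrite le_eqVlt; apply/orP; left; apply/eqP.
  have : Num.sqrt k ^ (- m) * Num.sqrt k ^ m = 1.
    by rewrite -sqrtzD// addNr expr0z.
  move: (_ ^ (- m)) (_ ^ m) => u v uv.
  by rewrite -[RHS]mulr1 -uv; ring.
Qed.

End finite_cofinite.

Definition square_integrable {R : realType} (f : R -> R) : Prop :=
  measurable_fun (Rpos : set (measurableTypeR R)) f /\
  lebesgue_measure.-integrable Rpos (EFin \o (fun s => f s ^+ 2)).

Section transformable.
Context {R : realType}.
Local Notation leb := (@lebesgue_measure R).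
Implicit Types (a b f : R -> R).

Lemma integrable_expR_Rpos (k : R) : 0 < k ->
  leb.-integrable Rpos (EFin \o (fun s => expR (- (k * s)))).
Proof. exact: integrable_expR_gt. Qed.

Lemma Rintegral_expR_Rpos (k : R) : 0 < k ->
  \int[leb]_(s in Rpos) expR (- (k * s)) = k^-1.
Proof. by move=> k0; rewrite Rintegral_expR_gt// mulr0 oppr0 expR0 mul1r. Qed.

(** The arithmetic-geometric mean inequality, scaled by sqrt(k), replaces
    Cauchy-Schwarz:
    2 |f| e^{-ks} <= sqrt(k) e^{-2ks} + f^2 / sqrt(k). *)
Lemma square_integrable_transformable f :
  square_integrable f -> transformable (- 1) f.
Proof.
move=> [mf if2].
have amgm (k s : R) : 0 < k -> `|f s| * expR (- (k * s)) <=
    (Num.sqrt k / 2) * expR (- ((2 * k) * s)) + ((Num.sqrt k)^-1 / 2) * f s ^+ 2.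
  move=> k0; have r0 : 0 < Num.sqrt k by rewrite sqrtr_gt0.
  have -> : expR (- ((2 * k) * s)) = expR (- (k * s)) ^+ 2.
    by rewrite expr2 -expRD; congr expR; ring.
  rewrite -(real_normK (num_real (f s))).
  move: (Num.sqrt k) r0 `|f s| (expR _) => r r0 x y.
  have -> : r / 2 * y ^+ 2 + r^-1 / 2 * x ^+ 2 =
      x * y + (r^-1 / 2) * (r * y - x) ^+ 2.
    by field; rewrite gt_eqF.
  by rewrite lerDl mulr_ge0 ?sqr_ge0// divr_ge0// invr_ge0 ltW.
have imaj (k : R) : 0 < k -> leb.-integrable Rpos (EFin \o (fun s =>
    (Num.sqrt k / 2) * expR (- ((2 * k) * s)) + ((Num.sqrt k)^-1 / 2) * f s ^+ 2)).
  move=> k0.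
  have k20 : 0 < 2 * k by rewrite mulr_gt0.
  exact: (integrableD measurable_Rpos
    (integrableZl measurable_Rpos (Num.sqrt k / 2) (integrable_expR_Rpos k20))
    (integrableZl measurable_Rpos ((Num.sqrt k)^-1 / 2) if2)).
have iabs (k : R) : 0 < k ->
    leb.-integrable Rpos (EFin \o (fun s => `|f s| * expR (- (k * s)))).
  move=> k0; apply: (le_integrable measurable_Rpos _ _ (imaj k k0)).
    apply/measurable_EFinP; apply: measurable_funM; last exact: measurable_expRM.
    exact: measurableT_comp.
  move=> s _ /=; rewrite lee_fin normrM normr_id ger0_norm ?expR_ge0//.
  by rewrite (le_trans (amgm k s k0))// ler_norm.
split => //.
- move=> k k0; apply: (le_integrable measurable_Rpos _ _ (iabs k k0)).
    by apply/measurable_EFinP; apply: measurable_funM => //; exact: measurable_expRM.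
  by move=> s _ /=; rewrite lee_fin !normrM normr_id.
- exists (4^-1 + (\int[leb]_(s in Rpos) (f s ^+ 2)) / 2) => k k0.
  rewrite (le_trans (le_Rintegral measurable_Rpos (iabs k k0) (imaj k k0) _))//.
    by move=> s _; exact: amgm.
  have k20 : 0 < 2 * k by rewrite mulr_gt0.
  rewrite RintegralD//; last 2 first.
    exact: (integrableZl measurable_Rpos (Num.sqrt k / 2) (integrable_expR_Rpos k20)).
    exact: (integrableZl measurable_Rpos ((Num.sqrt k)^-1 / 2) if2).
  rewrite !RintegralZl//; last exact: integrable_expR_Rpos.
  rewrite Rintegral_expR_Rpos// exprN1.
  have r0 : 0 < Num.sqrt k by rewrite sqrtr_gt0.
  move: (\int[_]_(_ in _) _) => I.
  rewrite le_eqVlt; apply/orP; left; apply/eqP.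
  rewrite -[in (2 * k)^-1](sqr_sqrtr (ltW k0)).
  by field; rewrite gt_eqF.
Qed.

Lemma bounded_transformable (M : R) f :
  measurable_fun (Rpos : set (measurableTypeR R)) f ->
  (forall s, 0 < s -> `|f s| <= M) -> transformable (- 2) f.
Proof.
move=> mf fM.
have imaj (k : R) : 0 < k ->
    leb.-integrable Rpos (EFin \o (fun s => M * expR (- (k * s)))).
  by move=> k0; exact: (integrableZl measurable_Rpos M (integrable_expR_Rpos k0)).
have iabs (k : R) : 0 < k ->
    leb.-integrable Rpos (EFin \o (fun s => `|f s| * expR (- (k * s)))).
  move=> k0; apply: (le_integrable measurable_Rpos _ _ (imaj k k0)).
    apply/measurable_EFinP; apply: measurable_funM; last exact: measurable_expRM.
    exact: measurableT_comp.
  move=> s; rewrite RposE => s0 /=; rewrite lee_fin !normrM normr_id.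
  by rewrite ler_wpM2r// (le_trans (fM _ s0))// ler_norm.
split => //.
- move=> k k0; apply: (le_integrable measurable_Rpos _ _ (iabs k k0)).
    by apply/measurable_EFinP; apply: measurable_funM => //; exact: measurable_expRM.
  by move=> s _ /=; rewrite lee_fin !normrM normr_id.
- exists M => k k0.
  rewrite (le_trans (le_Rintegral measurable_Rpos (iabs k k0) (imaj k k0) _))//.
    by move=> s; rewrite RposE => s0; rewrite ler_wpM2r ?expR_ge0 ?fM.
  rewrite RintegralZl//; last exact: integrable_expR_Rpos.
  by rewrite Rintegral_expR_Rpos// -exprz_inv -exprnP exprVn sqr_sqrtr ?(ltW k0).
Qed.

Lemma square_integrable_expR (l : R) : 0 < l ->
  square_integrable (fun s => expR (- (l * s))).
Proof.
move=> l0; split; first exact: measurable_expRM.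
have l20 : 0 < 2 * l by rewrite mulr_gt0.
apply: eq_integrable (integrable_expR_Rpos l20) => // s _ /=.
by congr EFin; rewrite expr2 -expRD; congr expR; ring.
Qed.

Lemma laplace_expR (l k : R) : 0 < l -> 0 < k ->
  laplace leb (fun s => expR (- (l * s))) k = (k + l)^-1.
Proof.
move=> l0 k0; rewrite -Rintegral_expR_Rpos ?addr_gt0//.
by apply: eq_Rintegral => s _; rewrite -expRD; congr expR; ring.
Qed.

End transformable.

(** * The transform of an amplitude *)

Section laplace_mu.
Context {R : realType}.
Variable mu : {finite_measure set (measurableTypeR R) -> \bar R}.
Hypothesis mu_cofinite : cofinite_on_Rpos mu.
Local Notation leb := (@lebesgue_measure R).
Implicit Types (a b f : R -> R).

(** Measurability in k comes from pairing f with the constant amplitude 1. *)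
Lemma growth_laplace_leb m n f : transformable m f -> - 4 <= m -> m <= 0 ->
  n - 4 <= m -> m <= n -> growth n (laplace leb f).
Proof.
move=> tf m4 m0 nm mn.
have g1 : growth 1 (cst 1 : R -> R) by exact: growth_cst.
have gm : growth (- m) (cst 1 : R -> R) by apply: growth_cst; lia.
have [_ h _] := duality mu_cofinite tf g1 gm.
apply: (@growth_pow _ m) => //.
  have /measurable_EFinP := measurable_int _ h.
  by apply: eq_measurable_fun => k _ /=; rewrite mul1r.
have [_ intf [C hC]] := tf.
by exists C => k k0; rewrite (le_trans (le_laplace_norm (intf k k0)))// hC.
Qed.

Lemma laplaceD a b t : 0 < t -> growth 1 a -> growth 1 b ->
  laplace mu (fun k => a k + b k) t = laplace mu a t + laplace mu b t.
Proof.
move=> t0 ga gb; rewrite /laplace -RintegralD//; last 2 first.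
  exact: growth1_laplace_integrable.
  exact: growth1_laplace_integrable.
by apply: eq_Rintegral => k _; rewrite mulrDl.
Qed.

Lemma laplaceZ c a t : 0 < t -> growth 1 a ->
  laplace mu (fun k => c * a k) t = c * laplace mu a t.
Proof.
move=> t0 ga; rewrite /laplace -RintegralZl//; last first.
  exact: growth1_laplace_integrable.
by apply: eq_Rintegral => k _; rewrite mulrA.
Qed.

Lemma transformable_expR (l : R) : 0 < l ->
  transformable (- 1) (fun s => expR (- (l * s))).
Proof.
by move=> l0; apply: square_integrable_transformable; exact: square_integrable_expR.
Qed.

(** The composite of the two transforms is the Stieltjes transform, as
    1 / (k + l) is the transform of e^{-ls} at k. *)
Lemma laplace_laplace a l : 0 < l -> growth 1 a ->
  [/\ leb.-integrable Rpos (EFin \o (fun s => laplace mu a s * expR (- (l * s)))),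
      mu.-integrable Rpos (EFin \o (fun k => a k / (k + l))) &
      laplace leb (laplace mu a) l = \int[mu]_(k in Rpos) (a k / (k + l))].
Proof.
move=> l0 ga.
have [h1 h2 h3] := duality mu_cofinite (transformable_expR l0) ga ga.
split.
- by apply: eq_integrable h1 => // s _ /=; rewrite mulrC.
- apply: eq_integrable h2 => // k /set_mem; rewrite RposE => k0 /=.
  by rewrite laplace_expR.
- transitivity (\int[leb]_(s in Rpos) (expR (- (l * s)) * laplace mu a s)).
    by apply: eq_Rintegral => s _; rewrite mulrC.
  rewrite h3; apply: eq_Rintegral => k /set_mem; rewrite RposE => k0.
  by rewrite laplace_expR.
Qed.

Lemma measurable_laplace_mu a : growth 1 a ->
  measurable_fun (Rpos : set (measurableTypeR R)) (laplace mu a).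
Proof.
move=> ga; have [h1 _ _] := laplace_laplace ltr01 ga.
have /measurable_EFinP m1 := measurable_int _ h1.
(* m1 is the measurability of the product with e^{-s}; multiply by e^s. *)
have := measurable_funM m1 (@measurable_expRM _ (- 1) Rpos).
apply: eq_measurable_fun => s _ /=.
by rewrite -mulrA -expRD mulN1r mul1r addrN expR0 mulr1.
Qed.

(** The kernel 1 / (k + l) is at most 1 / (2 sqrt(k) sqrt(l)), and amplitudes
    of class 1 are integrable against 1 / sqrt(l). *)
Lemma transformable_laplace_mu a : growth 1 a ->
  transformable (- 1) (laplace mu a).
Proof.
move=> ga; have mL := measurable_laplace_mu ga.
have gn := growth_norm ga.
split => //.
  by move=> k k0; have [] := laplace_laplace k0 ga.
have [_ [C hC]] := ga.
pose I := \int[mu]_(l in Rpos) (1 + l ^- 2).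
exists (C / 2 * I) => k k0.
have [j1 _ _] := laplace_laplace k0 ga.
have [i1 i2 i3] := laplace_laplace k0 gn.
have r0 : 0 < Num.sqrt k by rewrite sqrtr_gt0.
apply: (@le_trans _ _ (laplace leb (laplace mu (fun s => `|a s|)) k)).
  apply: le_Rintegral => //.
    have := integrable_norm j1; apply: eq_integrable => // s _ /=; congr EFin.
    by rewrite normrM (ger0_norm (expR_ge0 _)).
  move=> s; rewrite RposE => s0; rewrite ler_wpM2r ?expR_ge0//.
  by apply: le_laplace_norm; exact: growth1_laplace_integrable.
rewrite i3 exprN1 mulrAC -RintegralZl//; last exact: integrable_weight.
apply: le_Rintegral => //.
  exact: (integrableZl measurable_Rpos _ (integrable_weight mu_cofinite)).
move=> l; rewrite RposE => l0.
have := hC l l0; rewrite expr1z => h.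
have kl : 0 < l + k by rewrite addr_gt0.
rewrite ler_pdivrMr// (le_trans h)//.
have w0 : 0 <= C * (1 + l ^- 2).
  have := le_trans (normr_ge0 _) h; rewrite mulrCA pmulr_rge0//.
  by rewrite sqrtr_gt0.
have s0 : 0 < Num.sqrt l by rewrite sqrtr_gt0.
rewrite (_ : C * _ = (C * (1 + l ^- 2)) * Num.sqrt l); last by ring.
rewrite (_ : C / 2 / _ * _ * _ =
  (C * (1 + l ^- 2)) * ((l + k) / (2 * Num.sqrt k))); last first.
  by field; rewrite !gt_eqF.
rewrite ler_wpM2l// ler_pdivlMr ?mulr_gt0//.
rewrite -[in leRHS](sqr_sqrtr (ltW k0)) -[in leRHS](sqr_sqrtr (ltW l0)).
have := sqr_ge0 (Num.sqrt l - Num.sqrt k); nra.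
Qed.

(** Pair the transform with itself: the previous lemma allows to use it as the
    test function in the duality. *)
Lemma square_integrable_laplace_mu a : growth 1 a ->
  square_integrable (laplace mu a).
Proof.
move=> ga; split; first exact: measurable_laplace_mu.
have [+ _ _] := duality mu_cofinite (transformable_laplace_mu ga) ga ga.
exact.
Qed.

(** Duality with the indicator of ]t, +oo[, whose transform is e^{-tk} / k. *)
Lemma integral_laplace_mu a t : 0 <= t -> growth 1 a -> growth 2 a ->
  \int[leb]_(s in `]t, +oo[) laplace mu a s = laplace mu (fun k => k^-1 * a k) t.
Proof.
move=> t0 g1 g2.
pose J : set (measurableTypeR R) := `]t, +oo[%classic.
have mJ : measurable J by exact: measurable_itv.
have JR : Rpos `&` J = J.
  apply/seteqP; split => s; first by case.
  move=> Js; split => //; move: Js.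
  by rewrite /J /= in_itv /= andbT => ts; rewrite RposE (le_lt_trans t0 ts).
have tf : transformable (- 2) (\1_J : R -> R).
  apply: (@bounded_transformable _ 1).
    by apply: measurable_funTS; exact: measurable_indic.
  by move=> s _; rewrite indicE; case: (_ \in _); rewrite ?normr1 ?normr0.
have Lf (k : R) : 0 < k -> laplace leb (\1_J) k = k^-1 * expR (- (t * k)).
  move=> k0; rewrite mulrC (mulrC t) -Rintegral_expR_gt// -/J -{2}JR Rintegral_mkcondr.
  apply: eq_Rintegral => s _; rewrite patchE indicE.
  by case: ifPn => _; rewrite ?mul1r ?mul0r.
have [_ _ dual] := duality mu_cofinite tf g1 g2.
rewrite -/J -JR Rintegral_mkcondr.
transitivity (\int[leb]_(s in Rpos) (\1_J s * laplace mu a s)).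
  apply: eq_Rintegral => s _; rewrite patchE indicE.
  by case: ifPn => _; rewrite ?mul1r ?mul0r.
rewrite dual; apply: eq_Rintegral => k /set_mem; rewrite RposE => k0.
by rewrite Lf// mulrCA mulrA.
Qed.

(** The identity behind the whole proof, k / (k + l) = 1 - l / (k + l): it is
    integration by parts for the transform, with int a dmu as boundary value. *)
Lemma laplace_shift a l : 0 < l -> growth 0 a -> growth 1 a ->
  growth 1 (fun k => k * a k) ->
  laplace leb (laplace mu (fun k => k * a k)) l =
  \int[mu]_(k in Rpos) a k - l * laplace leb (laplace mu a) l.
Proof.
move=> l0 g0 g1 g1'.
have [_ i1 ->] := laplace_laplace l0 g1'.
have [_ i2 ->] := laplace_laplace l0 g1.
rewrite -RintegralZl// -RintegralB//; last 2 first.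
- exact: growth0_integrable.
- exact: (integrableZl measurable_Rpos l i2).
apply: eq_Rintegral => k /set_mem; rewrite RposE => k0.
by field; rewrite gt_eqF// addr_gt0.
Qed.

End laplace_mu.

(** * Almost everywhere equality and pointwise regularity *)

#[local] Instance ae_lebesgue_filter (R : realType) :
  Filter (nbhs (almost_everywhere (@lebesgue_measure R))).
Proof. exact: ae_filter_ringOfSetsType. Qed.

Section ae_Rpos.
Context {R : realType}.
Local Notation leb := (@lebesgue_measure R).

Lemma ae_Rpos_exists (P : R -> Prop) (x y : R) : 0 <= x -> x < y ->
  {ae leb, forall t, Rpos t -> P t} -> exists2 t, x < t < y & P t.
Proof.
move=> x0 xy [N [mN N0 PN]]; apply: contrapT => /forall2NP nP.
have sub : (`]x, y[%classic : set R) `<=` N.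
  move=> t /=; rewrite in_itv /= => /andP[xt ty].
  apply: PN => /= Pt; have [|] := nP t; first by rewrite xt ty.
  by apply; apply: Pt; rewrite RposE (le_lt_trans x0 xt).
have : (leb (`]x, y[%classic : set R) <= 0)%E.
  by rewrite -N0; apply: le_measure => //; rewrite inE//; exact: measurable_itv.
rewrite lebesgue_measure_itv /= lte_fin xy -EFinB lee_fin subr_le0.
by rewrite leNgt xy.
Qed.

Lemma ae_Rpos_eq_continuous (u v : R -> R) :
  {ae leb, forall t, Rpos t -> u t = v t} ->
  (forall t, 0 < t -> {for t, continuous u}) ->
  (forall t, 0 < t -> {for t, continuous v}) ->
  forall t, 0 < t -> u t = v t.
Proof.
move=> uv cu cv t t0; apply/eqP; rewrite -subr_eq0; apply/negPn/negP => d0.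
have cw : {for t, continuous (u \- v)}.
  by apply: continuousB; [exact: cu|exact: cv].
have e0 : 0 < `|u t - v t| by rewrite normr_gt0.
have /cvgrPdist_lt/(_ _ e0) := cw.
move=> [e /= e1 H].
have [s /andP[ts se] us] := @ae_Rpos_exists (fun t => u t = v t) t (t + e) (ltW t0)
  ltac:(by rewrite ltrDl) uv.
have := H s; rewrite /= us subrr subr0 ltxx.
have ste : `|t - s| < e by rewrite distrC gtr0_norm ?subr_gt0// ltrBlDl.
by move=> /(_ ste).
Qed.

Lemma derivable_for_continuous (u : R -> R) t :
  derivable u t 1 -> {for t, continuous u}.
Proof. by move=> du; apply: differentiable_continuous; exact/derivable1_diffP. Qed.

Lemma derive1_eq_Rpos (u v : R -> R) t : (forall t, 0 < t -> u t = v t) ->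
  0 < t -> derive1 u t = derive1 v t.
Proof.
move=> uv t0; rewrite !derive1E; apply: near_eq_derive.
near=> s; apply: uv; near: s; exact: lt_nbhsr.
Unshelve. all: by end_near. Qed.

End ae_Rpos.

Section complex_ae.
Context {R : realType}.
Implicit Types f g u v w : R -> R[i].

Lemma aeq_sym f g : aeq f g -> aeq g f.
Proof. exact: ae_eq_sym. Qed.

Lemma aeq_trans f g h : aeq f g -> aeq g h -> aeq f h.
Proof. exact: ae_eq_trans. Qed.

Lemma aeq_Rpos f g : (forall t, 0 < t -> f t = g t) -> aeq f g.
Proof. by move=> fg; apply: aeW => t; rewrite RposE; exact: fg. Qed.

Lemma aeq_Re f g : aeq f g ->
  {ae (@lebesgue_measure R), forall t, Rpos t -> complex.Re (f t) = complex.Re (g t)}.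
Proof. by apply: filterS => t fg Rt; rewrite fg. Qed.

Lemma aeq_Im f g : aeq f g ->
  {ae (@lebesgue_measure R), forall t, Rpos t -> complex.Im (f t) = complex.Im (g t)}.
Proof. by apply: filterS => t fg Rt; rewrite fg. Qed.

(** Differentiable representatives are continuous, so two of them that agree
    almost everywhere agree on R_+; the choice made by [diff_repr] is therefore
    immaterial. *)
Lemma cderive_diff_repr u w : aeq u w -> (forall t, 0 < t -> cderivable w t) ->
  forall t, 0 < t -> cderive (diff_repr u) t = cderive w t.
Proof.
move=> uw dw t t0.
pose P := [set v | aeq v u /\ forall t, 0 < t -> cderivable v t].
have [vu dv] : P (diff_repr u).
  by apply: xgetPex; exists w; split => //; exact: aeq_sym.
have vw := aeq_trans vu uw.
have reE := ae_Rpos_eq_continuous (aeq_Re vw)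
  (fun s s0 => derivable_for_continuous (dv s s0).1)
  (fun s s0 => derivable_for_continuous (dw s s0).1).
have imE := ae_Rpos_eq_continuous (aeq_Im vw)
  (fun s s0 => derivable_for_continuous (dv s s0).2)
  (fun s s0 => derivable_for_continuous (dw s s0).2).
by congr (_ +i* _); apply: derive1_eq_Rpos.
Qed.

End complex_ae.

(** * Differentiation and positivity *)

Section laplace_derive.
Context {R : realType}.
Variable mu : {finite_measure set (measurableTypeR R) -> \bar R}.
Hypothesis mu_cofinite : cofinite_on_Rpos mu.
Implicit Types (a b : R -> R).

Lemma laplace_derive b t : 0 < t -> growth 1 b -> growth 1 (fun k => k * b k) ->
  derivable (laplace mu b) t 1 /\
  derive1 (laplace mu b) t = - laplace mu (fun k => k * b k) t.
Proof.
move=> t0 gb gkb.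
pose f (x k : R) := b k * expR (- (x * k)).
have df (x k : R) : is_derive x 1 (f ^~ k) (- (k * b k * expR (- (x * k)))).
  rewrite /f; apply: is_derive_eq.
  by rewrite /GRing.scale /=; ring.
pose G (k : R) := `|k * b k * expR (- (t / 2 * k))|.
have t20 : 0 < t / 2 by rewrite divr_gt0.
have Ia : (`](t / 2), (t + 1)[%classic : set R) t.
  by rewrite /= in_itv /=; apply/andP; split; lra.
have intf x : (`](t / 2), (t + 1)[%classic : set R) x ->
    mu.-integrable Rpos (EFin \o f x).
  rewrite /= in_itv /= => /andP[tx _].
  by apply: growth1_laplace_integrable => //; exact: lt_trans tx.
have der x k : (`](t / 2), (t + 1)[%classic : set R) x -> Rpos k ->
    derivable (f ^~ k) x 1.
  by move=> _ _; have [] := df x k.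
have intG : mu.-integrable Rpos (EFin \o G).
  exact: (integrable_norm (growth1_laplace_integrable mu_cofinite t20 gkb)).
have d1E x k : partial1of2 f x k = - (k * b k * expR (- (x * k))).
  by rewrite partial1of2E; case: (df x k).
have G_ub x k : (`](t / 2), (t + 1)[%classic : set R) x -> Rpos k ->
    `|partial1of2 f x k| <= G k.
  rewrite /= in_itv /= RposE => /andP[tx _] k0.
  rewrite d1E normrN /G !(normrM (_ * _)) ler_wpM2l//.
  rewrite !ger0_norm ?expR_ge0// ler_expR lerN2 ler_wpM2r ?ltW//.
have G0 k : 0 <= G k by exact: normr_ge0.
split.
  exact: (derivable_under_integral measurable_Rpos Ia intf der G0 intG G_ub).
have := differentiation_under_integral measurable_Rpos Ia intf der G0 intG G_ub.
rewrite /laplace => ->.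
rewrite -[RHS]mulN1r -RintegralZl//; last exact: growth1_laplace_integrable.
by apply: eq_Rintegral => k _; rewrite d1E mulN1r.
Qed.

(** Positivity of H: the pairing of f with H f is the integral of the square of
    the transform of f, so -E int f^2 >= 0. *)
Lemma laplace_energy_le0 (E : R) f : 0 < E -> square_integrable f ->
  {ae (@lebesgue_measure R), forall t, Rpos t ->
     laplace mu (laplace lebesgue_measure f) t + E * f t = 0} ->
  {ae (@lebesgue_measure R), forall t, Rpos t -> f t = 0}.
Proof.
move=> E0 [mf if2] Hf.
set g := laplace lebesgue_measure f in Hf *.
have tf := square_integrable_transformable (conj mf if2).
have gg n : - 1 <= n -> n <= 3 -> growth n g.
  by move=> n1 n2; apply: (growth_laplace_leb mu_cofinite tf) => //; lia.
have [h1 h2 h3] := duality mu_cofinite tf (gg 1 isT isT) (gg 1 isT isT).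
have pos : 0 <= \int[mu]_(k in Rpos) (g k * g k).
  by apply: Rintegral_ge0 => k _; rewrite -expr2 sqr_ge0.
have neg : \int[lebesgue_measure]_(s in Rpos) (f s * laplace mu g s) =
    - E * \int[lebesgue_measure]_(s in Rpos) (f s ^+ 2).
  rewrite -RintegralZl//; congr fine; apply: ae_eq_integral => //.
  - exact: (measurable_int _ h1).
  - apply/measurable_EFinP; apply: measurable_funM => //.
    exact: measurable_funX.
  - apply: filterS Hf => t /= + Rt => /(_ Rt) /eqP.
    by rewrite addr_eq0 => /eqP ->; congr EFin; ring.
have I0 : 0 <= \int[lebesgue_measure]_(s in Rpos) (f s ^+ 2).
  by apply: Rintegral_ge0 => s _; exact: sqr_ge0.
have Ieq : \int[lebesgue_measure]_(s in Rpos) (f s ^+ 2) = 0.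
  move: h3 pos I0; rewrite neg -/g => <-.
  move: (\int[_]_(_ in _) _) => J; rewrite mulNr oppr_ge0 pmulr_rle0// => J0 J1.
  by apply/eqP; rewrite eq_le J0 J1.
have /ae_eq_integral_abs : (\int[lebesgue_measure]_(x in Rpos) `|(f x ^+ 2)%:E| = 0)%E.
  rewrite -(@fineK _ (\int[_]_(x in _) _)%E).
    under eq_integral => x _ do rewrite gee0_abs ?lee_fin ?sqr_ge0//.
    by rewrite -/(Rintegral _ _ _) Ieq.
  by have := integrable_fin_num measurable_Rpos (integrable_abse if2).
move=> /(_ measurable_Rpos (measurable_int _ if2)).
apply: filterS => t /= + Rt => /(_ Rt) [] /eqP.
by rewrite sqrf_eq0 => /eqP.
Qed.

End laplace_derive.

(** * Complex-valued functions *)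

Lemma Lfun2_RposP {R : realType} (f : R -> R) :
  f \_ Rpos \in Lfun (@lebesgue_measure R) 2%:E <-> square_integrable f.
Proof.
split => [fL2|[mf if2]].
- have := Lfun2_integrable_sqr fL2.
  move: fL2; rewrite inE => /andP[+ _]; rewrite inE /= => mf if2; split.
    by apply/(measurable_restrictT _ measurable_Rpos).
  apply/(integrable_mkcond _ measurable_Rpos).
  apply: eq_integrable if2 => // s _; rewrite /= !patchE.
  by case: ifPn => // _; rewrite expr0n.
- have mfT := (measurable_restrictT _ measurable_Rpos).1 mf.
  rewrite inE; apply/andP; split; rewrite inE//=.
  rewrite /finite_norm unlock /Lnorm; apply: poweR_lty.
  have /integrableP[_] := (integrable_mkcond _ measurable_Rpos).1 if2.
  apply: le_lt_trans; rewrite le_eqVlt; apply/orP; left; apply/eqP.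
  apply: eq_integral => s _; rewrite /= !patchE; case: ifPn => _ /=.
    by rewrite powR_mulrn// real_normK ?num_real// ger0_norm// sqr_ge0.
  by rewrite !normr0 powR0.
Qed.

Lemma cReM {R : realType} (x y : R[i]) : complex.Re (x * y) =
  complex.Re x * complex.Re y + (- complex.Im x) * complex.Im y.
Proof. by case: x y => a b [c d] /=; rewrite mulNr. Qed.

Lemma cImM {R : realType} (x y : R[i]) : complex.Im (x * y) =
  complex.Re x * complex.Im y + complex.Im x * complex.Re y.
Proof. by case: x y => a b [c d]. Qed.

Lemma cReD {R : realType} (x y : R[i]) :
  complex.Re (x + y) = complex.Re x + complex.Re y.
Proof. by case: x y => a b [c d]. Qed.

Lemma cImD {R : realType} (x y : R[i]) :
  complex.Im (x + y) = complex.Im x + complex.Im y.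
Proof. by case: x y => a b [c d]. Qed.

Lemma complex_ext {R : realType} (x y : R[i]) :
  complex.Re x = complex.Re y -> complex.Im x = complex.Im y -> x = y.
Proof. by case: x y => a b [c d] /= -> ->. Qed.

Section complex_integral.
Context {R : realType}.
Variable m : borel_measure R.
Implicit Types (f g : R -> R[i]) (D : set (measurableTypeR R)).

Definition cint D f : R[i] :=
  (\int[m]_(x in D) complex.Re (f x)) +i* (\int[m]_(x in D) complex.Im (f x)).

Definition cintegrable D f : Prop :=
  m.-integrable D (EFin \o (@complex.Re R \o f)) /\
  m.-integrable D (EFin \o (@complex.Im R \o f)).

Lemma eq_cint D f g : {in D, f =1 g} -> cint D f = cint D g.
Proof.
move=> fg; congr (_ +i* _); apply: eq_Rintegral => x Dx; by rewrite fg.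
Qed.

Lemma eq_cintegrable D f g : measurable D -> {in D, f =1 g} ->
  cintegrable D f -> cintegrable D g.
Proof.
move=> mD fg [h1 h2]; split.
- by apply: eq_integrable h1 => // x Dx /=; rewrite fg.
- by apply: eq_integrable h2 => // x Dx /=; rewrite fg.
Qed.

Lemma integrable_lin D (a b : R -> R) x y : measurable D ->
  m.-integrable D (EFin \o a) -> m.-integrable D (EFin \o b) ->
  m.-integrable D (EFin \o (fun s => x * a s + y * b s)).
Proof.
move=> mD ia ib.
exact: (integrableD mD (integrableZl mD x ia) (integrableZl mD y ib)).
Qed.

Lemma Rintegral_lin D (a b : R -> R) x y : measurable D ->
  m.-integrable D (EFin \o a) -> m.-integrable D (EFin \o b) ->
  \int[m]_(s in D) (x * a s + y * b s) =
  x * \int[m]_(s in D) a s + y * \int[m]_(s in D) b s.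
Proof.
move=> mD ia ib; rewrite RintegralD//.
- by rewrite !RintegralZl.
- exact: (integrableZl mD x ia).
- exact: (integrableZl mD y ib).
Qed.

Lemma cintegrableD D f g : measurable D -> cintegrable D f -> cintegrable D g ->
  cintegrable D (fun x => f x + g x).
Proof.
move=> mD [f1 f2] [g1 g2]; split.
- by apply: eq_integrable (integrableD mD f1 g1) => // x _ /=; rewrite cReD.
- by apply: eq_integrable (integrableD mD f2 g2) => // x _ /=; rewrite cImD.
Qed.

Lemma cintegrableZ D f (c : R[i]) : measurable D -> cintegrable D f ->
  cintegrable D (fun x => c * f x).
Proof.
move=> mD [f1 f2]; split.
- apply: eq_integrable (integrable_lin (complex.Re c) (- complex.Im c) mD f1 f2) => //.
  by move=> x _ /=; rewrite cReM.
- apply: eq_integrable (integrable_lin (complex.Re c) (complex.Im c) mD f2 f1) => //.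
  by move=> x _ /=; rewrite cImM.
Qed.

Lemma cintD D f g : measurable D -> cintegrable D f -> cintegrable D g ->
  cint D (fun x => f x + g x) = cint D f + cint D g.
Proof.
move=> mD [f1 f2] [g1 g2]; apply: complex_ext => /=.
- by rewrite -RintegralD//; apply: eq_Rintegral => x _; rewrite cReD.
- by rewrite -RintegralD//; apply: eq_Rintegral => x _; rewrite cImD.
Qed.

Lemma cintZ D f (c : R[i]) : measurable D -> cintegrable D f ->
  cint D (fun x => c * f x) = c * cint D f.
Proof.
move=> mD [f1 f2]; apply: complex_ext.
- rewrite cReM /= -Rintegral_lin//; apply: eq_Rintegral => x _.
  by rewrite cReM.
- rewrite cImM /= -Rintegral_lin//; apply: eq_Rintegral => x _.
  by rewrite cImM.
Qed.

Lemma cintegrableB D f g : measurable D -> cintegrable D f -> cintegrable D g ->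
  cintegrable D (fun x => f x - g x).
Proof.
move=> mD if1 ig1; apply: eq_cintegrable (cintegrableD mD if1 (cintegrableZ (-1) mD ig1)) => //.
by move=> x _; rewrite mulN1r.
Qed.

Lemma cintB D f g : measurable D -> cintegrable D f -> cintegrable D g ->
  cint D (fun x => f x - g x) = cint D f - cint D g.
Proof.
move=> mD if1 ig1; rewrite -mulN1r -cintZ// -cintD//; last exact: cintegrableZ.
by apply: eq_cint => x _; rewrite mulN1r.
Qed.

Definition claplace f (x : R) : R[i] :=
  laplace m (@complex.Re R \o f) x +i* laplace m (@complex.Im R \o f) x.

Lemma claplaceE f x :
  claplace f x = cint Rpos (fun y => f y * (expR (- (x * y)))%:C).
Proof.
apply: complex_ext => /=; apply: eq_Rintegral => y _.
- by rewrite cReM /= mulr0 addr0.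
- by rewrite cImM /= mulr0 add0r.
Qed.

Lemma Re_claplace f : @complex.Re R \o claplace f = laplace m (@complex.Re R \o f).
Proof. by []. Qed.

Lemma Im_claplace f : @complex.Im R \o claplace f = laplace m (@complex.Im R \o f).
Proof. by []. Qed.

Lemma eq_claplace f g : (forall k, 0 < k -> f k = g k) ->
  claplace f =1 claplace g.
Proof.
move=> fg x; rewrite !claplaceE; apply: eq_cint => y /set_mem.
by rewrite RposE => /fg ->.
Qed.

End complex_integral.

Section complex_growth.
Context {R : realType}.
Implicit Types (a b : R -> R[i]) (n : int).

Definition cgrowth n a : Prop :=
  growth n (@complex.Re R \o a) /\ growth n (@complex.Im R \o a).

Lemma eq_growth n (a b : R -> R) : (forall k, 0 < k -> a k = b k) ->
  growth n a -> growth n b.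
Proof.
move=> ab [ma [C hC]]; split.
  by apply: eq_measurable_fun ma => k /set_mem; rewrite RposE => /ab.
by exists C => k k0; rewrite -ab// hC.
Qed.

Lemma eq_cgrowth n a b : (forall k, 0 < k -> a k = b k) ->
  cgrowth n a -> cgrowth n b.
Proof.
by move=> ab [ga gb]; split; [apply: eq_growth ga|apply: eq_growth gb] => k k0 /=;
  rewrite ab.
Qed.

Lemma cgrowthD n a b : cgrowth n a -> cgrowth n b ->
  cgrowth n (fun k => a k + b k).
Proof.
move=> [a1 a2] [b1 b2]; split.
- by apply: eq_growth (growthD a1 b1) => k _ /=; rewrite cReD.
- by apply: eq_growth (growthD a2 b2) => k _ /=; rewrite cImD.
Qed.

Lemma cgrowthZ n (c : R[i]) a : cgrowth n a -> cgrowth n (fun k => c * a k).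
Proof.
move=> [a1 a2]; split.
- apply: eq_growth (growthD (growthZ (complex.Re c) a1) (growthZ (- complex.Im c) a2)).
  by move=> k _ /=; rewrite cReM.
- apply: eq_growth (growthD (growthZ (complex.Re c) a2) (growthZ (complex.Im c) a1)).
  by move=> k _ /=; rewrite cImM.
Qed.

Lemma cgrowth_cst n (c : R[i]) : 0 <= n -> n <= 4 -> cgrowth n (fun=> c).
Proof. by move=> n0 n4; split; exact: growth_cst. Qed.

Lemma cgrowth_mul n a : cgrowth n a -> cgrowth (n + 2) (fun k => k%:C * a k).
Proof.
move=> [a1 a2]; split.
- by apply: eq_growth (growth_mul a1) => k _ /=; rewrite cReM /= oppr0 mul0r addr0.
- by apply: eq_growth (growth_mul a2) => k _ /=; rewrite cImM /= mul0r addr0.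
Qed.

Lemma cgrowth_div n a : cgrowth (n + 2) a ->
  cgrowth n (fun k => (k^-1)%:C * a k).
Proof.
move=> [a1 a2]; split.
- by apply: eq_growth (growth_div a1) => k _ /=; rewrite cReM /= oppr0 mul0r addr0.
- by apply: eq_growth (growth_div a2) => k _ /=; rewrite cImM /= mul0r addr0.
Qed.

End complex_growth.

Lemma L2P {R : realType} (f : R -> R[i]) : L2 f <->
  square_integrable (@complex.Re R \o f) /\ square_integrable (@complex.Im R \o f).
Proof.
by split => -[/Lfun2_RposP h1 /Lfun2_RposP h2].
Qed.

(** * The Hankel operator as a composite of two transforms *)

Section complex_transform.
Context {R : realType}.
Variable mu : {finite_measure set (measurableTypeR R) -> \bar R}.
Hypothesis mu_cofinite : cofinite_on_Rpos mu.
Local Notation leb := (@lebesgue_measure R).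
Implicit Types (f g u v w a b : R -> R[i]) (n : int).

Lemma cgrowth0_cintegrable a : cgrowth 0 a -> cintegrable mu Rpos a.
Proof. by move=> [a1 a2]; split; exact: growth0_integrable. Qed.

Lemma cgrowth_claplace_leb n f : L2 f -> - 1 <= n -> n <= 3 ->
  cgrowth n (claplace leb f).
Proof.
move=> /L2P[/square_integrable_transformable t1 /square_integrable_transformable t2].
move=> n1 n2; split; [apply: (growth_laplace_leb mu_cofinite t1)|
  apply: (growth_laplace_leb mu_cofinite t2)] => //; lia.
Qed.

Lemma claplace_muD a b t : 0 < t -> cgrowth 1 a -> cgrowth 1 b ->
  claplace mu (fun k => a k + b k) t = claplace mu a t + claplace mu b t.
Proof.
move=> t0 [a1 a2] [b1 b2]; apply: complex_ext; rewrite /claplace.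
- rewrite cReD /= -laplaceD//; apply: eq_laplace => k _ /=; exact: cReD.
- rewrite cImD /= -laplaceD//; apply: eq_laplace => k _ /=; exact: cImD.
Qed.

Lemma claplace_muZ (c : R[i]) a t : 0 < t -> cgrowth 1 a ->
  claplace mu (fun k => c * a k) t = c * claplace mu a t.
Proof.
move=> t0 [a1 a2]; apply: complex_ext; rewrite /claplace.
- rewrite cReM /= -!laplaceZ// -laplaceD//; try exact: growthZ.
  by apply: eq_laplace => k _ /=; exact: cReM.
- rewrite cImM /= -!laplaceZ// -laplaceD//; try exact: growthZ.
  by apply: eq_laplace => k _ /=; exact: cImM.
Qed.

Lemma L2_claplace_mu a : cgrowth 1 a -> L2 (claplace mu a).
Proof. by move=> [a1 a2]; apply/L2P; split; exact: square_integrable_laplace_mu. Qed.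

Lemma claplace_shift a l : 0 < l -> cgrowth 0 a -> cgrowth 1 a ->
  cgrowth 1 (fun k => k%:C * a k) ->
  claplace leb (claplace mu (fun k => k%:C * a k)) l =
  cint mu Rpos a - l%:C * claplace leb (claplace mu a) l.
Proof.
move=> l0 [a1 a2] [b1 b2] [c1 c2].
have reE k : complex.Re (k%:C * a k) = k * complex.Re (a k).
  by rewrite cReM /= oppr0 mul0r addr0.
have imE k : complex.Im (k%:C * a k) = k * complex.Im (a k).
  by rewrite cImM /= mul0r addr0.
have re := laplace_shift mu_cofinite l0 a1 b1 (eq_growth (fun k _ => reE k) c1).
have im := laplace_shift mu_cofinite l0 a2 b2 (eq_growth (fun k _ => imE k) c2).
have sub (p q x y : R) : p +i* q - l%:C * (x +i* y) = (p - l * x) +i* (q - l * y).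
  by apply: complex_ext; rewrite /= ?mul0r ?subr0 ?addr0.
have reF : @complex.Re R \o (fun k => k%:C * a k) = _ := funext reE.
have imF : @complex.Im R \o (fun k => k%:C * a k) = _ := funext imE.
rewrite {1}/claplace !Re_claplace !Im_claplace reF imF re im.
exact: (esym (sub _ _ _ _)).
Qed.

(** H = L L': duality of f with the amplitude e^{-tk}, whose transform at s is
    h(t + s). *)
Lemma Hankel_claplace f t : L2 f -> 0 < t ->
  Hankel mu f t = claplace mu (claplace leb f) t.
Proof.
move=> /L2P[f1 f2] t0.
have g1 : growth 1 (fun k => expR (- (t * k))).
  split; first exact: measurable_expRM.
  have [_ [C hC]] := @growth_cst R 1 1 isT isT.
  exists C => k k0; rewrite (le_trans _ (hC k k0))// normr1 ger0_norm ?expR_ge0//.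
  by rewrite expR_le1 oppr_le0 mulr_ge0// ltW.
have key (h : R -> R) : square_integrable h ->
    \int[leb]_(s in Rpos) (hmu mu (t + s) * h s) = laplace mu (laplace leb h) t.
  move=> h2.
  have [_ _ e] := duality mu_cofinite (square_integrable_transformable h2) g1 g1.
  transitivity (\int[leb]_(s in Rpos) (h s * laplace mu (fun k => expR (- (t * k))) s)).
    apply: eq_Rintegral => s _; rewrite mulrC; congr (_ * _).
    by apply: eq_Rintegral => k _; rewrite -expRD; congr expR; ring.
  by rewrite e; apply: eq_Rintegral => k _; rewrite mulrC.
apply: complex_ext; rewrite /Hankel /cintegral /=.
- rewrite -key//; apply: eq_Rintegral => s _.
  by rewrite cReM /= oppr0 mul0r addr0.
- rewrite -key//; apply: eq_Rintegral => s _.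
  by rewrite cImM /= mul0r addr0.
Qed.

Lemma integral_claplace_mu a t : 0 <= t -> cgrowth 1 a -> cgrowth 2 a ->
  cintegral `]t, +oo[ (claplace mu a) = claplace mu (fun k => (k^-1)%:C * a k) t.
Proof.
move=> t0 [a1 a2] [b1 b2].
apply: complex_ext => /=.
- rewrite (integral_laplace_mu mu_cofinite t0 a1 b1).
  by apply: eq_laplace => k _ /=; rewrite cReM /= oppr0 mul0r addr0.
- rewrite (integral_laplace_mu mu_cofinite t0 a2 b2).
  by apply: eq_laplace => k _ /=; rewrite cImM /= mul0r addr0.
Qed.

(** The pairing is bilinear, without conjugation: this is the form in which the
    symmetry of H is used. *)
Lemma cduality f a : L2 f -> cgrowth 1 a ->
  [/\ cintegrable leb Rpos (fun s => f s * claplace mu a s),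
      cintegrable mu Rpos (fun k => a k * claplace leb f k) &
      cintegral Rpos (fun s => f s * claplace mu a s) =
      cint mu Rpos (fun k => a k * claplace leb f k)].
Proof.
move=> /L2P[/square_integrable_transformable f1 /square_integrable_transformable f2].
move=> [a1 a2].
have [i11 j11 e11] := duality mu_cofinite f1 a1 a1.
have [i12 j12 e12] := duality mu_cofinite f1 a2 a2.
have [i21 j21 e21] := duality mu_cofinite f2 a1 a1.
have [i22 j22 e22] := duality mu_cofinite f2 a2 a2.
split.
- split.
  + apply: eq_integrable (integrable_lin 1 (-1) measurable_Rpos i11 i22) => // s _ /=.
    by rewrite cReM /=; congr EFin; ring.
  + apply: eq_integrable (integrable_lin 1 1 measurable_Rpos i12 i21) => // s _ /=.
    by rewrite cImM /=; congr EFin; ring.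
- split.
  + apply: eq_integrable (integrable_lin 1 (-1) measurable_Rpos j11 j22) => // s _ /=.
    by rewrite cReM /=; congr EFin; ring.
  + apply: eq_integrable (integrable_lin 1 1 measurable_Rpos j12 j21) => // s _ /=.
    by rewrite cImM /=; congr EFin; ring.
apply: complex_ext.
- transitivity (\int[leb]_(s in Rpos) (1 * (complex.Re (f s) * laplace mu (@complex.Re R \o a) s)
     + (-1) * (complex.Im (f s) * laplace mu (@complex.Im R \o a) s))).
    by apply: eq_Rintegral => s _; rewrite cReM /=; ring.
  rewrite Rintegral_lin// e11 e22 -Rintegral_lin//.
  by apply: eq_Rintegral => s _; rewrite cReM /=; ring.
- transitivity (\int[leb]_(s in Rpos) (1 * (complex.Re (f s) * laplace mu (@complex.Im R \o a) s)
     + 1 * (complex.Im (f s) * laplace mu (@complex.Re R \o a) s))).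
    by apply: eq_Rintegral => s _; rewrite cImM /=; ring.
  rewrite Rintegral_lin// e12 e21 -Rintegral_lin//.
  by apply: eq_Rintegral => s _; rewrite cImM /=; ring.
Qed.

Lemma claplace_derive b t : 0 < t -> cgrowth 1 b ->
  cgrowth 1 (fun k => k%:C * b k) ->
  cderivable (claplace mu b) t /\
  cderive (claplace mu b) t = - claplace mu (fun k => k%:C * b k) t.
Proof.
move=> t0 [b1 b2] [c1 c2].
have reE k : complex.Re (k%:C * b k) = k * complex.Re (b k).
  by rewrite cReM /= oppr0 mul0r addr0.
have imE k : complex.Im (k%:C * b k) = k * complex.Im (b k).
  by rewrite cImM /= mul0r addr0.
have [d1 e1] := laplace_derive mu_cofinite t0 b1 (eq_growth (fun k _ => reE k) c1).
have [d2 e2] := laplace_derive mu_cofinite t0 b2 (eq_growth (fun k _ => imE k) c2).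
split; first exact: (conj d1 d2).
apply: complex_ext => /=.
- by rewrite [LHS]e1; congr (- _); apply: eq_laplace => k _ /=; rewrite reE.
- by rewrite [LHS]e2; congr (- _); apply: eq_laplace => k _ /=; rewrite imE.
Qed.

Lemma hmuC_claplace t : hmuC mu t = claplace mu (fun=> 1) t.
Proof.
apply: complex_ext => /=.
- by apply: eq_Rintegral => k _; rewrite mul1r.
- by rewrite /laplace; under eq_Rintegral => k _ do rewrite /= mul0r;
    rewrite /Rintegral integral0.
Qed.

Lemma cgrowth_inv n : - 2 <= n -> n <= 2 -> cgrowth n (fun k : R => (k^-1)%:C).
Proof.
move=> n1 n2; apply: (@eq_cgrowth _ _ (fun k : R => (k^-1)%:C * 1)).
  by move=> k _; rewrite mulr1.
by apply: cgrowth_div; apply: cgrowth_cst; lia.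
Qed.

Lemma hmu_intC_claplace t : 0 <= t ->
  hmu_intC mu t = claplace mu (fun k => (k^-1)%:C) t.
Proof.
move=> t0.
have g n : 0 <= n -> n <= 4 -> cgrowth n (fun=> 1 : R[i]) by exact: cgrowth_cst.
have e := integral_claplace_mu t0 (g 1 isT isT) (g 2 isT isT).
rewrite (@eq_claplace _ mu _ (fun k => (k^-1)%:C * 1)); last by move=> k _; rewrite mulr1.
rewrite -e; apply: complex_ext => /=.
- by apply: eq_Rintegral => s _; rewrite -[RHS]/(complex.Re (claplace mu (fun=> 1) s)) -hmuC_claplace.
- rewrite /Rintegral integral0_eq// => s _.
  by rewrite -[laplace _ _ _]/(complex.Im (claplace mu (fun=> 1) s)) -hmuC_claplace.
Qed.

End complex_transform.

(** * Linearity and invariance under almost everywhere equality *)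

Section ae_integrals.
Context {R : realType}.
Local Notation leb := (@lebesgue_measure R).
Implicit Types (f g u v : R -> R[i]).

Definition cmeasurable (D : set (measurableTypeR R)) f : Prop :=
  measurable_fun D (@complex.Re R \o f) /\ measurable_fun D (@complex.Im R \o f).

Lemma cintegrable_cmeasurable m (D : set (measurableTypeR R)) f :
  cintegrable m D f -> cmeasurable D f.
Proof. by move=> [/measurable_int/measurable_EFinP h1 /measurable_int/measurable_EFinP h2]. Qed.

Lemma L2_cmeasurable f : L2 f -> cmeasurable Rpos f.
Proof. by move=> /L2P[[h1 _] [h2 _]]. Qed.

Lemma cintegral_ae (D : set (measurableTypeR R)) f g : measurable D -> D `<=` Rpos ->
  cmeasurable D f -> cmeasurable D g -> aeq f g -> cintegral D f = cintegral D g.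
Proof.
move=> mD DR [f1 f2] [g1 g2] fg; congr (_ +i* _); congr fine;
  apply: ae_eq_integral => //; try exact/measurable_EFinP;
  by apply: filterS fg => t fg Dt; rewrite fg//; exact: DR.
Qed.

Lemma cmeasurableS (D D' : set (measurableTypeR R)) f : measurable D' -> D `<=` D' ->
  cmeasurable D' f -> cmeasurable D f.
Proof. by move=> mD DD [h1 h2]; split; [exact: measurable_funS h1|exact: measurable_funS h2]. Qed.

Lemma itv_gt_sub_Rpos (t : R) : 0 <= t -> `]t, +oo[%classic `<=` (Rpos : set R).
Proof.
by move=> t0 s /=; rewrite in_itv /= andbT RposE => /(le_lt_trans t0).
Qed.

Lemma L2_integral_ae t f g : 0 <= t -> L2 f -> L2 g -> aeq f g ->
  cintegral `]t, +oo[ f = cintegral `]t, +oo[ g.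
Proof.
move=> t0 f2 g2 fg; apply: cintegral_ae => //.
- exact: itv_gt_sub_Rpos.
- by apply: cmeasurableS (L2_cmeasurable f2) => //; exact: itv_gt_sub_Rpos.
- by apply: cmeasurableS (L2_cmeasurable g2) => //; exact: itv_gt_sub_Rpos.
Qed.

Lemma L2_cintegrable_expR f k : L2 f -> 0 < k ->
  cintegrable leb Rpos (fun s => f s * (expR (- (k * s)))%:C).
Proof.
move=> /L2P[/square_integrable_transformable[_ h1 _]].
move=> /square_integrable_transformable[_ h2 _] k0; split.
- apply: eq_integrable (h1 k k0) => // s _; rewrite [RHS]/= cReM /=.
  by rewrite mulr0 addr0.
- apply: eq_integrable (h2 k k0) => // s _; rewrite [RHS]/= cImM /=.
  by rewrite mulr0 add0r.
Qed.

Lemma claplace_leb_ae f g k : L2 f -> L2 g -> aeq f g -> 0 < k ->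
  claplace leb f k = claplace leb g k.
Proof.
move=> f2 g2 fg k0; rewrite !claplaceE; apply: cintegral_ae => //.
- exact: cintegrable_cmeasurable (L2_cintegrable_expR f2 k0).
- exact: cintegrable_cmeasurable (L2_cintegrable_expR g2 k0).
- by apply: filterS fg => s fg Rs; rewrite fg.
Qed.

Lemma eq_L2 f g : (forall t, 0 < t -> f t = g t) -> L2 f -> L2 g.
Proof.
have E (h : R[i] -> R) : (forall t, 0 < t -> f t = g t) ->
    (h \o f) \_ Rpos = (h \o g) \_ Rpos.
  move=> fg; apply/funext => t; rewrite !patchE; case: ifPn => // /set_mem.
  by rewrite RposE => /fg /= ->.
by move=> fg [h1 h2]; split; rewrite -E.
Qed.

Lemma square_integrable_lin (f g : R -> R) x y :
  square_integrable f -> square_integrable g ->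
  square_integrable (fun s => x * f s + y * g s).
Proof.
move=> [mf if2] [mg ig2]; have mfg : measurable_fun (Rpos : set (measurableTypeR R))
    (fun s => x * f s + y * g s).
  by apply: measurable_funD; exact: measurable_funM.
split => //.
have imaj := integrable_lin (2 * x ^+ 2) (2 * y ^+ 2) measurable_Rpos if2 ig2.
apply: (le_integrable measurable_Rpos _ _ imaj).
  by apply/measurable_EFinP; exact: measurable_funX.
move=> s _ /=; rewrite lee_fin ger0_norm ?sqr_ge0// (le_trans _ (ler_norm _))//.
rewrite -subr_ge0 (_ : _ - _ = (x * f s - y * g s) ^+ 2) ?sqr_ge0//.
by ring.
Qed.

Lemma L2_lin (c d : R[i]) f g : L2 f -> L2 g -> L2 (fun t => c * f t + d * g t).
Proof.
move=> /L2P[f1 f2] /L2P[g1 g2]; apply/L2P; split.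
- rewrite (_ : _ \o _ = (fun t => 1 * (complex.Re c * complex.Re (f t) + - complex.Im c * complex.Im (f t))
    + 1 * (complex.Re d * complex.Re (g t) + - complex.Im d * complex.Im (g t)))).
    by do 2?apply: square_integrable_lin.
  by apply/funext => t; rewrite /= !mul1r cReD !cReM.
- rewrite (_ : _ \o _ = (fun t => 1 * (complex.Re c * complex.Im (f t) + complex.Im c * complex.Re (f t))
    + 1 * (complex.Re d * complex.Im (g t) + complex.Im d * complex.Re (g t)))).
    by do 2?apply: square_integrable_lin.
  by apply/funext => t; rewrite /= !mul1r cImD !cImM.
Qed.

Lemma claplace_leb_lin (c d : R[i]) f g k : L2 f -> L2 g -> 0 < k ->
  claplace leb (fun t => c * f t + d * g t) k =
  c * claplace leb f k + d * claplace leb g k.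
Proof.
move=> f2 g2 k0; rewrite !claplaceE.
have if2 := L2_cintegrable_expR f2 k0; have ig2 := L2_cintegrable_expR g2 k0.
rewrite -!cintZ// -cintD//; try exact: cintegrableZ.
by apply: eq_cint => s _; rewrite mulrDl !mulrA.
Qed.

End ae_integrals.

(** * The shift identity for the Hankel operator *)

Section Hankel_shift.
Context {R : realType}.
Variable mu : {finite_measure set (measurableTypeR R) -> \bar R}.
Hypothesis mu_cofinite : cofinite_on_Rpos mu.
Local Notation leb := (@lebesgue_measure R).
Implicit Types (f g u v w a b : R -> R[i]).

(** The hypothesis is the resolvent or the eigenvalue equation on the spectral
    side: (c, z) = (1, E) for the solution of (H + E) w = h^int, and (0, -E) for
    an eigenvector. The conclusion is the equation satisfied by the derivative of
    L b. *)
Lemma Hankel_raise b (c z : R[i]) t :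
  cgrowth 0 b -> cgrowth 1 b -> cgrowth 1 (fun k => k%:C * b k) ->
  (forall l, 0 < l -> l%:C * claplace leb (claplace mu b) l = c - z * (l%:C * b l)) ->
  0 < t ->
  Hankel mu (claplace mu (fun k => k%:C * b k)) t =
  (cint mu Rpos b - c) * hmuC mu t + z * claplace mu (fun k => k%:C * b k) t.
Proof.
move=> b0 b1 kb1 hb t0.
rewrite Hankel_claplace//; last exact: L2_claplace_mu.
have g1 : cgrowth 1 (fun=> 1 : R[i]) by exact: cgrowth_cst.
rewrite (@eq_claplace _ mu _ (fun k => (cint mu Rpos b - c) * 1 + z * (k%:C * b k))).
  rewrite claplace_muD//; try exact: cgrowthZ.
  by rewrite !claplace_muZ// hmuC_claplace.
move=> k k0; rewrite claplace_shift// hb//.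
by ring.
Qed.

(** The mirror statement: the hypothesis concerns L (k b), the conclusion its
    primitive L b. The same two values of (c, z) occur, the first one now for
    (H + E) u = h. *)
Lemma Hankel_lower b (c z : R[i]) t :
  cgrowth 0 b -> cgrowth 1 b -> cgrowth 1 (fun k => k%:C * b k) ->
  (forall l, 0 < l -> claplace leb (claplace mu (fun k => k%:C * b k)) l =
     c - z * (l%:C * b l)) ->
  0 < t ->
  Hankel mu (claplace mu b) t =
  (cint mu Rpos b - c) * hmu_intC mu t + z * claplace mu b t.
Proof.
move=> b0 b1 kb1 hb t0.
rewrite Hankel_claplace//; last exact: L2_claplace_mu.
have g1 : cgrowth 1 (fun k : R => (k^-1)%:C) by exact: cgrowth_inv.
rewrite (@eq_claplace _ mu _ (fun k => (cint mu Rpos b - c) * (k^-1)%:C + z * b k)).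
  rewrite claplace_muD//; try exact: cgrowthZ.
  by rewrite !claplace_muZ// hmu_intC_claplace ?ltW.
move=> k k0; have := claplace_shift mu_cofinite k0 b0 b1 kb1.
rewrite hb// => e.
have kC0 : k%:C != 0 :> R[i] by rewrite eq_complex /= eqxx andbT gt_eqF.
apply: (mulfI kC0); rewrite mulrDr mulrCA -(rmorphM (real_complex R)) mulfV ?gt_eqF//.
rewrite rmorph1 mulr1 [k%:C * claplace _ _ _](_ : _ = cint mu Rpos b - (c - z * (k%:C * b k))).
  by ring.
by rewrite e; ring.
Qed.

Lemma resolvent_repr (E : R[i]) u G : E != 0 -> L2 u -> cgrowth 1 G ->
  aeq (add_scalar (Hankel mu) E u) (claplace mu G) ->
  aeq u (claplace mu (fun k => E^-1 * (G k - claplace leb u k))).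
Proof.
move=> E0 u2 G1; apply: filterS => t + Rt; move=> /(_ Rt).
move: Rt; rewrite RposE => t0.
have Lu : cgrowth 1 (claplace leb u) by exact: (cgrowth_claplace_leb mu_cofinite).
rewrite /add_scalar Hankel_claplace//.
rewrite claplace_muZ//; last first.
  apply: (@eq_cgrowth _ _ (fun k => G k + (-1) * claplace leb u k)).
    by move=> k _; rewrite mulN1r.
  by apply: cgrowthD => //; exact: cgrowthZ.
rewrite (@eq_claplace _ mu (fun k => G k - claplace leb u k) (fun k => G k + (-1) * claplace leb u k)); last first.
  by move=> k _; rewrite mulN1r.
rewrite claplace_muD//; last exact: cgrowthZ.
rewrite claplace_muZ// => <-.
by rewrite mulN1r addrAC subrr add0r mulKf.
Qed.

End Hankel_shift.

(** * The functions phi and theta as transforms *)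

Section Hankel_linear.
Context {R : realType}.
Variable mu : {finite_measure set (measurableTypeR R) -> \bar R}.
Hypothesis mu_cofinite : cofinite_on_Rpos mu.
Local Notation leb := (@lebesgue_measure R).
Implicit Types (f g u v w a b : R -> R[i]).

Lemma realC_neq0 (k : R) : 0 < k -> k%:C != 0 :> R[i].
Proof. by move=> k0; rewrite eq_complex /= eqxx andbT gt_eqF. Qed.

Lemma realC_mulV (k : R) : 0 < k -> k%:C * (k^-1)%:C = 1 :> R[i].
Proof. by move=> k0; rewrite -(rmorphM (real_complex R)) mulfV ?gt_eqF. Qed.

Lemma eq_Hankel f g : (forall t, 0 < t -> f t = g t) -> Hankel mu f = Hankel mu g.
Proof.
move=> fg; apply/funext => t; apply: eq_cint => s /set_mem.
by rewrite RposE => s0; rewrite fg.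
Qed.

Lemma Hankel_lin (c d : R[i]) f g t : L2 f -> L2 g -> 0 < t ->
  Hankel mu (fun s => c * f s + d * g s) t = c * Hankel mu f t + d * Hankel mu g t.
Proof.
move=> f2 g2 t0; rewrite !Hankel_claplace//; last exact: L2_lin.
have gf : cgrowth 1 (claplace leb f) by exact: (cgrowth_claplace_leb mu_cofinite).
have gg : cgrowth 1 (claplace leb g) by exact: (cgrowth_claplace_leb mu_cofinite).
rewrite -!claplace_muZ// -claplace_muD//; try exact: cgrowthZ.
by apply: eq_claplace => k k0; exact: claplace_leb_lin.
Qed.

Lemma HankelN f t : L2 f -> 0 < t -> Hankel mu (fun s => - f s) t = - Hankel mu f t.
Proof.
move=> f2 t0; rewrite (@eq_Hankel _ (fun s => (-1) * f s + 0 * f s)).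
  by rewrite Hankel_lin// mul0r addr0 mulN1r.
by move=> s _; rewrite mul0r addr0 mulN1r.
Qed.

Lemma L2N f : L2 f -> L2 (fun s => - f s).
Proof.
move=> f2; apply: eq_L2 (L2_lin (-1) 0 f2 f2) => t _.
by rewrite mul0r addr0 mulN1r.
Qed.

Lemma L2_0 : L2 (cst 0 : R -> R[i]).
Proof.
have h : square_integrable (cst 0 : R -> R).
  split => //; have h0 : leb.-integrable Rpos (cst 0%E) by exact: integrable0.
  by apply: eq_integrable h0 => // s _ /=; rewrite expr0n.
by apply/L2P.
Qed.

Lemma claplace0 (m : borel_measure R) k : claplace m (cst 0) k = 0.
Proof.
by apply: complex_ext; rewrite /= /laplace /Rintegral integral0_eq// => y _;
  rewrite mul0r.
Qed.

Lemma claplace_leb_ae0 f k : L2 f -> aeq f (cst 0) -> 0 < k -> claplace leb f k = 0.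
Proof. by move=> f2 f0 k0; rewrite (claplace_leb_ae f2 L2_0 f0 k0) claplace0. Qed.

Lemma phi_claplace (E : R[i]) a t : 0 < t -> cgrowth 1 a -> cgrowth 2 a ->
  L2 (op_inv (add_scalar (Hankel mu) E) (hmuC mu)) ->
  aeq (op_inv (add_scalar (Hankel mu) E) (hmuC mu)) (claplace mu a) ->
  phi mu E t = - claplace mu (fun k => (k^-1)%:C * a k) t.
Proof.
move=> t0 a1 a2 u2 ua; rewrite /phi; congr (- _).
rewrite (L2_integral_ae (ltW t0) u2 (L2_claplace_mu mu_cofinite a1) ua).
exact: (integral_claplace_mu mu_cofinite (ltW t0) a1 a2).
Qed.

Lemma theta_claplace (E : R[i]) b t : 0 < t -> cgrowth 1 b ->
  cgrowth 1 (fun k => k%:C * b k) ->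
  aeq (op_inv (add_scalar (Hankel mu) E) (hmu_intC mu)) (claplace mu b) ->
  theta mu E t = - claplace mu (fun k => k%:C * b k) t.
Proof.
move=> t0 b1 kb1 wb; rewrite /theta (cderive_diff_repr wb)//.
  by have [_ ->] := claplace_derive mu_cofinite t0 b1 kb1.
by move=> s s0; have [] := claplace_derive mu_cofinite s0 b1 kb1.
Qed.

Lemma op_invP (T : operator R) g : (exists f, L2 f /\ aeq (T f) g) ->
  L2 (op_inv T g) /\ aeq (T (op_inv T g)) g.
Proof. exact: xgetPex. Qed.

End Hankel_linear.

(** * Solutions of the resolvent equations *)

Section resolvent.
Context {R : realType}.
Variable mu : {finite_measure set (measurableTypeR R) -> \bar R}.
Hypothesis mu_cofinite : cofinite_on_Rpos mu.
Variable E : R[i].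
Hypothesis E_neq0 : E != 0.
Local Notation leb := (@lebesgue_measure R).
Local Notation T := (add_scalar (Hankel mu) E).
Variables u w a b : R -> R[i].
Hypothesis uE : op_inv T (hmuC mu) = u.
Hypothesis wE : op_inv T (hmu_intC mu) = w.
Hypotheses (u_L2 : L2 u) (w_L2 : L2 w).
Hypothesis Tu : aeq (T u) (hmuC mu).
Hypothesis Tw : aeq (T w) (hmu_intC mu).
Hypothesis aE : forall k, a k = E^-1 * (1 - claplace leb u k).
Hypothesis bE : forall k, b k = E^-1 * ((k^-1)%:C - claplace leb w k).

Let a_growth n : 0 <= n -> n <= 3 -> cgrowth n a.
Proof.
move=> n0 n3; apply: (@eq_cgrowth _ _ (fun k => E^-1 * (1 + (-1) * claplace leb u k))).
  by move=> k _; rewrite aE mulN1r.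
apply: cgrowthZ.
apply: cgrowthD; first by apply: cgrowth_cst; lia.
by apply: cgrowthZ; apply: (cgrowth_claplace_leb mu_cofinite) => //; lia.
Qed.

Let b_growth n : - 1 <= n -> n <= 2 -> cgrowth n b.
Proof.
move=> n0 n3; apply: (@eq_cgrowth _ _ (fun k => E^-1 * ((k^-1)%:C + (-1) * claplace leb w k))).
  by move=> k _; rewrite bE mulN1r.
apply: cgrowthZ.
apply: cgrowthD; first by apply: cgrowth_inv; lia.
by apply: cgrowthZ; apply: (cgrowth_claplace_leb mu_cofinite) => //; lia.
Qed.

Let u_ae : aeq u (claplace mu a).
Proof.
rewrite (funext aE); apply: (resolvent_repr mu_cofinite E_neq0 u_L2 (G := fun=> 1)).
  exact: cgrowth_cst.
by apply: filterS Tu => t h Rt; rewrite h// hmuC_claplace.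
Qed.

Let w_ae : aeq w (claplace mu b).
Proof.
rewrite (funext bE).
apply: (resolvent_repr mu_cofinite E_neq0 w_L2 (G := fun k => (k^-1)%:C)).
  exact: cgrowth_inv.
apply: filterS Tw => t h Rt; rewrite h// hmu_intC_claplace//.
by move: Rt; rewrite RposE => /ltW.
Qed.

Let laplace_u l : 0 < l -> claplace leb (claplace mu a) l = 1 - E * a l.
Proof.
move=> l0.
rewrite -(claplace_leb_ae u_L2 (L2_claplace_mu mu_cofinite (@a_growth 1 isT isT)) u_ae l0).
by rewrite aE mulrA mulfV// mul1r subKr.
Qed.

Let laplace_w l : 0 < l -> claplace leb (claplace mu b) l = (l^-1)%:C - E * b l.
Proof.
move=> l0.
rewrite -(claplace_leb_ae w_L2 (L2_claplace_mu mu_cofinite (@b_growth 1 isT isT)) w_ae l0).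
by rewrite bE mulrA mulfV// mul1r subKr.
Qed.

(* [va] is the amplitude of - phi. *)
Let va (k : R) : R[i] := (k^-1)%:C * a k.

Let mul_va k : 0 < k -> k%:C * va k = a k.
Proof. by move=> k0; rewrite /va mulrA realC_mulV// mul1r. Qed.

Let va_growth n : - 2 <= n -> n <= 1 -> cgrowth n va.
Proof. by move=> n0 n1; apply: cgrowth_div; apply: a_growth; lia. Qed.

Let kb_growth : cgrowth 1 (fun k => k%:C * b k).
Proof. exact: (cgrowth_mul (@b_growth (- 1) isT isT)). Qed.

Let kva_growth : cgrowth 1 (fun k => k%:C * va k).
Proof. by apply: eq_cgrowth (@a_growth 1 isT isT) => k k0; rewrite mul_va. Qed.

(** The symmetry of H. Duality evaluates int u w in two ways: since u = L a, as
    the integral of a L' w = a (1/k - E b), and since w = L b, as that of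
    b L' u = b (1 - E a). The terms in E cancel, and a/k and b remain. *)
Lemma cint_symmetry : cint mu Rpos b = cint mu Rpos va.
Proof.
have [i1 j1 e1] := cduality mu_cofinite w_L2 (@a_growth 1 isT isT).
have [i2 j2 e2] := cduality mu_cofinite u_L2 (@b_growth 1 isT isT).
have e : cint mu Rpos (fun k => a k * claplace leb w k) =
         cint mu Rpos (fun k => b k * claplace leb u k).
  apply: etrans (esym e1) (etrans _ e2); apply: cintegral_ae => //.
  - exact: cintegrable_cmeasurable i1.
  - exact: cintegrable_cmeasurable i2.
  - apply: filterS2 u_ae w_ae => t hu hw Rt.
    by rewrite -[in LHS]hu// -[in RHS]hw// mulrC.
have ib : cintegrable mu Rpos b.
  exact: (cgrowth0_cintegrable mu_cofinite (@b_growth 0 isT isT)).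
have ika : cintegrable mu Rpos va.
  exact: (cgrowth0_cintegrable mu_cofinite (@va_growth 0 isT isT)).
have h1 := cintB measurable_Rpos ib ika.
have h2 := cintB measurable_Rpos j2 j1.
have h3 : cint mu Rpos (fun k => b k - va k) =
    cint mu Rpos (fun k => b k * claplace leb u k - a k * claplace leb w k).
  apply: eq_cint => k _; rewrite /va aE bE.
  by move: (claplace leb u k) (claplace leb w k) => x y; ring.
by apply/eqP; rewrite -subr_eq0 -h1 h3 h2 e subrr.
Qed.

Lemma Delta_cint : Delta mu E = 1 - cint mu Rpos va.
Proof.
have g n : 0 <= n -> n <= 4 -> cgrowth n (fun=> 1 : R[i]) by exact: cgrowth_cst.
have gi n : - 2 <= n -> n <= 2 -> cgrowth n (fun k : R => (k^-1)%:C) by exact: cgrowth_inv.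
have hE : (\int[leb]_(t in Rpos) hmu mu t)%:C = cint mu Rpos (fun k => (k^-1)%:C).
  have e := integral_claplace_mu mu_cofinite (lexx 0) (g 1 isT isT) (g 2 isT isT).
  transitivity (cintegral `]0, +oo[ (claplace mu (fun=> 1))).
    apply: complex_ext => /=.
      by apply: eq_Rintegral => s _;
        rewrite -[RHS]/(complex.Re (claplace mu (fun=> 1) s)) -hmuC_claplace.
    rewrite /Rintegral integral0_eq// => s _.
    by rewrite -[laplace _ _ _]/(complex.Im (claplace mu (fun=> 1) s)) -hmuC_claplace.
  rewrite e claplaceE; apply: eq_cint => k _.
  by rewrite mul0r oppr0 expR0 !mulr1.
have innerE : L2inner u (hmu_intC mu) =
    cint mu Rpos (fun k => (k^-1)%:C * claplace leb u k).
  have [_ _ <-] := cduality mu_cofinite u_L2 (gi 1 isT isT).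
  apply: eq_cint => s /set_mem; rewrite RposE => s0.
  rewrite -hmu_intC_claplace ?ltW//; congr (_ * _).
  exact: conjc_real.
have [_ j _] := cduality mu_cofinite u_L2 (gi 1 isT isT).
have igi : cintegrable mu Rpos (fun k => (k^-1)%:C).
  exact: (cgrowth0_cintegrable mu_cofinite (gi 0 isT isT)).
have h1 := cintB measurable_Rpos igi j.
have h2 := cintZ E^-1 measurable_Rpos (cintegrableB measurable_Rpos igi j).
rewrite /Delta uE innerE hE.
have -> : cint mu Rpos va = E^-1 * cint mu Rpos
    (fun k => (k^-1)%:C - (k^-1)%:C * claplace leb u k).
  rewrite -h2; apply: eq_cint => k _; rewrite /va aE.
  by move: (claplace leb u k) => x; ring.
rewrite h1; move: (cint _ _ _) (cint _ _ _) => x y.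
by ring.
Qed.

Lemma phi_repr t : 0 < t -> phi mu E t = - claplace mu va t.
Proof. move=> t0; apply: (phi_claplace mu_cofinite t0 (@a_growth 1 isT isT) (@a_growth 2 isT isT));
  by rewrite uE. Qed.

Lemma theta_repr t : 0 < t -> theta mu E t = - claplace mu (fun k => k%:C * b k) t.
Proof. move=> t0; apply: (theta_claplace mu_cofinite t0 (@b_growth 1 isT isT) kb_growth).
by rewrite wE. Qed.

Lemma phi_L2 : L2 (phi mu E).
Proof.
apply: (@eq_L2 _ (fun t => - claplace mu va t)).
  by move=> t t0; rewrite phi_repr.
by apply: L2N; exact: (L2_claplace_mu mu_cofinite (@va_growth 1 isT isT)).
Qed.

Lemma theta_L2 : L2 (theta mu E).
Proof.
apply: (@eq_L2 _ (fun t => - claplace mu (fun k => k%:C * b k) t)).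
  by move=> t t0; rewrite theta_repr.
by apply: L2N; exact: (L2_claplace_mu mu_cofinite kb_growth).
Qed.

Lemma Hankel_phi t : 0 < t ->
  add_scalar (Hankel mu) (- E) (phi mu E) t = Delta mu E * hmu_intC mu t.
Proof.
move=> t0; rewrite /add_scalar phi_repr// (eq_Hankel mu phi_repr) HankelN//; last first.
  by exact: (L2_claplace_mu mu_cofinite (@va_growth 1 isT isT)).
rewrite (@Hankel_lower _ _ mu_cofinite va 1 E t)//; try exact: va_growth.
  by rewrite Delta_cint; ring.
by move=> l l0; rewrite (funext (eq_claplace mu mul_va)) (laplace_u l0) (mul_va l0).
Qed.

Lemma Hankel_theta t : 0 < t ->
  add_scalar (Hankel mu) (- E) (theta mu E) t = Delta mu E * hmuC mu t.
Proof.
move=> t0; rewrite /add_scalar theta_repr// (eq_Hankel mu theta_repr) HankelN//; last first.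
  by exact: (L2_claplace_mu mu_cofinite kb_growth).
rewrite (@Hankel_raise _ _ mu_cofinite b 1 E t)//; try exact: b_growth.
  by rewrite Delta_cint -cint_symmetry; ring.
move=> l l0; rewrite (laplace_w l0) mulrBr realC_mulV//.
by ring.
Qed.

(** If phi = 0, the shift identity makes L' u constant, equal to int a/k dmu, and
    this constant is 1 when Delta = 0; then a = 0, hence u = 0 and h = 0. *)
Lemma phi_ae0_Delta0 : Delta mu E = 0 -> aeq (phi mu E) (cst 0) -> aeq (hmuC mu) (cst 0).
Proof.
rewrite Delta_cint => /eqP; rewrite subr_eq0 => /eqP D1 phi0.
have a0 k : 0 < k -> a k = 0.
  move=> k0.
  have va0 : claplace leb (claplace mu va) k = 0.
    apply: claplace_leb_ae0 => //.
      by exact: (L2_claplace_mu mu_cofinite (@va_growth 1 isT isT)).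
    apply: filterS phi0 => t + Rt => /(_ Rt); move: Rt; rewrite RposE => t0.
    by rewrite phi_repr// => /eqP; rewrite oppr_eq0 => /eqP.
  have := claplace_shift mu_cofinite k0 (@va_growth 0 isT isT) (@va_growth 1 isT isT) kva_growth.
  rewrite va0 mulr0 subr0 -D1 => e.
  have : claplace leb (claplace mu a) k = 1.
    by rewrite -(funext (eq_claplace mu mul_va)).
  rewrite (laplace_u k0) => /eqP; rewrite subr_eq -subr_eq0 opprD addrA subrr sub0r oppr_eq0.
  by rewrite mulf_eq0 (negbTE E_neq0) /= => /eqP.
have u0 : aeq u (cst 0).
  apply: filterS u_ae => t h Rt; rewrite h// (@eq_claplace _ mu _ (cst 0)) ?claplace0//.
have u0' := u0; apply: filterS2 Tu u0' => t h1 h2 Rt; rewrite -h1// /add_scalar h2// mulr0 addr0.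
move: Rt; rewrite RposE => t0; rewrite Hankel_claplace//.
rewrite (@eq_claplace _ mu _ (cst 0)) ?claplace0// => k k0.
exact: (claplace_leb_ae0 u_L2 u0 k0).
Qed.

End resolvent.

(** * Zero belongs to the spectrum *)

Section spectrum0.
Context {R : realType}.
Variable mu : {finite_measure set (measurableTypeR R) -> \bar R}.
Hypothesis mu_cofinite : cofinite_on_Rpos mu.
Local Notation leb := (@lebesgue_measure R).

(** The transform is continuous at 1, the step is not. *)
Lemma laplace_not_step (g : R -> R) :
  growth 1 g -> growth 1 (fun k => k * g k) ->
  ~ {ae leb, forall t, Rpos t -> laplace mu g t = \1_(`]0, 1[%classic : set R) t}.
Proof.
move=> g1 kg1 W.
have [dW _] := laplace_derive mu_cofinite ltr01 g1 kg1.
have h0 : 0 < (1 / 2 : R) by lra.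
have /cvgrPdist_lt/(_ _ h0) := derivable_for_continuous dW.
move=> [e /= e0 H].
pose d := Num.min e 1.
have d0 : 0 < d by rewrite lt_min e0 ltr01.
have de : d <= e by rewrite ge_min lexx.
have d1 : d <= 1 by rewrite ge_min lexx orbT.
have [s /andP[s1 s2] Ws] := @ae_Rpos_exists R _ (1 - d) 1 ltac:(lra) ltac:(lra) W.
have [t /andP[t1 t2] Wt] := @ae_Rpos_exists R _ 1 (1 + d) ltac:(lra) ltac:(lra) W.
have hs : `|laplace mu g 1 - laplace mu g s| < 1 / 2.
  by apply: H; rewrite /= gtr0_norm ?subr_gt0//; lra.
have ht : `|laplace mu g 1 - laplace mu g t| < 1 / 2.
  by apply: H; rewrite /= distrC gtr0_norm ?subr_gt0//; lra.
move: hs ht; rewrite Ws Wt !indicE mem_set; last by rewrite /= in_itv /=; lra.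
rewrite memNset; last by rewrite /= in_itv /=; lra.
rewrite /= mulr1n mulr0n !ltr_norml => /andP[h1 h2] /andP[h3 h4].
clear - h1 h4; lra.
Qed.

Lemma boundedly_invertible_neq0 (E : R[i]) :
  boundedly_invertible (add_scalar (Hankel mu) E) -> E != 0.
Proof.
move=> [_ [C surj]]; apply/negP => /eqP E0.
pose J : set (measurableTypeR R) := `]0, 1[%classic.
pose g (t : R) : R[i] := (\1_J t : R)%:C.
have mJ : measurable J by exact: measurable_itv.
have m1 : measurable_fun (Rpos : set (measurableTypeR R)) (\1_J : R -> R).
  by apply: measurable_funTS; exact: measurable_indic.
have g2 : L2 g.
  apply/L2P; split.
    split; first exact: m1.
    have h : leb.-integrable Rpos (EFin \o (\1_J : R -> R)).
      by apply: integrableS (integrable_indic_itv 0 1 false true) => //.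
    apply: eq_integrable h => // s _ /=; rewrite indicE.
    by case: (_ \in _); rewrite ?expr1n ?expr0n.
  have h : leb.-integrable Rpos (cst 0%E) by exact: integrable0.
  split; first exact: measurable_cst.
  by apply: eq_integrable h => // s _ /=; rewrite expr0n.
have [f [f2 Hf _]] := surj g g2.
move/L2P: (f2) => [/square_integrable_transformable tf _].
have gr n : - 1 <= n -> n <= 3 -> growth n (laplace leb (@complex.Re R \o f)).
  by move=> n1 n2; apply: (growth_laplace_leb mu_cofinite tf) => //; lia.
apply: (@laplace_not_step (laplace leb (@complex.Re R \o f))).
- exact: gr.
- exact: (growth_mul (@gr (- 1) isT isT)).
apply: filterS Hf => t + Rt => /(_ Rt); move: Rt; rewrite RposE => t0.
rewrite /add_scalar E0 mul0r addr0 Hankel_claplace// => e.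
exact: (congr1 (@complex.Re R) e).
Qed.

End spectrum0.

(** * Eigenvectors for positive eigenvalues *)

Section positive_spectrum.
Context {R : realType}.
Variable mu : {finite_measure set (measurableTypeR R) -> \bar R}.
Hypothesis mu_cofinite : cofinite_on_Rpos mu.
Variable E : R.
Hypothesis E_gt0 : 0 < E.
Local Notation leb := (@lebesgue_measure R).
Local Notation T := (add_scalar (Hankel mu) E%:C).
Implicit Types f g : R -> R[i].

Lemma add_scalar_pos_injective f : L2 f -> aeq (T f) (cst 0) -> aeq f (cst 0).
Proof.
move=> f2 Tf; have /L2P[fr fi] := f2.
have re : {ae leb, forall t, Rpos t -> complex.Re (f t) = 0}.
  apply: (laplace_energy_le0 mu_cofinite E_gt0 fr).
  apply: filterS Tf => t + Rt => /(_ Rt); move: Rt; rewrite RposE => t0.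
  rewrite /add_scalar Hankel_claplace// => /(congr1 (@complex.Re R)).
  by rewrite cReD cReM /= oppr0 mul0r addr0.
have im : {ae leb, forall t, Rpos t -> complex.Im (f t) = 0}.
  apply: (laplace_energy_le0 mu_cofinite E_gt0 fi).
  apply: filterS Tf => t + Rt => /(_ Rt); move: Rt; rewrite RposE => t0.
  rewrite /add_scalar Hankel_claplace// => /(congr1 (@complex.Im R)).
  by rewrite cImD cImM /= mul0r addr0.
by apply: filterS2 re im => t h1 h2 Rt; apply: complex_ext; [exact: h1|exact: h2].
Qed.

Lemma add_scalar_pos_unique f g G : L2 f -> L2 g ->
  aeq (T f) G -> aeq (T g) G -> aeq f g.
Proof.
move=> f2 g2 Tf Tg.
have d2 := L2_lin 1 (-1) f2 g2.
have : aeq (fun t => 1 * f t + (-1) * g t) (cst 0).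
  apply: add_scalar_pos_injective => //.
  apply: filterS2 Tf Tg => t h1 h2 Rt; have := h1 Rt; have := h2 Rt.
  move: Rt; rewrite RposE => t0.
  rewrite /add_scalar Hankel_lin// => e1 e2.
  rewrite [LHS](_ : _ = (Hankel mu f t + E%:C * f t) - (Hankel mu g t + E%:C * g t)).
    by rewrite e1 e2 subrr.
  by ring.
apply: filterS => t + Rt => /(_ Rt) /eqP.
by rewrite mul1r mulN1r subr_eq0 => /eqP.
Qed.

Variable psi : R -> R[i].
Hypothesis psi_eigen : eigenvector (Hankel mu) E%:C psi.

Let psi_L2 : L2 psi. Proof. by case: psi_eigen. Qed.

Let EC0 : E%:C != 0 :> R[i]. Proof. exact: realC_neq0. Qed.

Variable g : R -> R[i].
Hypothesis gE : forall k, g k = (E%:C)^-1 * claplace leb psi k.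

Let g_growth n : - 1 <= n -> n <= 3 -> cgrowth n g.
Proof.
move=> n1 n3; rewrite (funext gE); apply: cgrowthZ.
exact: (cgrowth_claplace_leb mu_cofinite).
Qed.

Let psi_ae : aeq psi (claplace mu g).
Proof.
have [_ _] := psi_eigen; apply: filterS => t + Rt => /(_ Rt).
move: Rt; rewrite RposE => t0.
rewrite Hankel_claplace// (funext gE) claplace_muZ//; last first.
  exact: (cgrowth_claplace_leb mu_cofinite).
by move=> ->; rewrite mulKf.
Qed.

Let laplace_g l : 0 < l -> claplace leb (claplace mu g) l = E%:C * g l.
Proof.
move=> l0; rewrite -(claplace_leb_ae psi_L2 (L2_claplace_mu mu_cofinite
  (@g_growth 1 isT isT)) psi_ae l0).
by rewrite gE mulVKf.
Qed.

Let g_nonzero : ~ (forall k, 0 < k -> g k = 0).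
Proof.
move=> g0; have [_ + _] := psi_eigen; apply.
apply: filterS psi_ae => t h Rt; rewrite h//.
by rewrite (@eq_claplace _ mu _ (cst 0)) ?claplace0.
Qed.

Let kg_growth : cgrowth 1 (fun k => k%:C * g k).
Proof. exact: (cgrowth_mul (@g_growth (- 1) isT isT)). Qed.

Let vg (k : R) : R[i] := (k^-1)%:C * g k.

Let vg_growth n : - 3 <= n -> n <= 1 -> cgrowth n vg.
Proof. by move=> n0 n1; apply: cgrowth_div; apply: g_growth; lia. Qed.

Let mul_vg k : 0 < k -> k%:C * vg k = g k.
Proof. by move=> k0; rewrite /vg mulrA realC_mulV// mul1r. Qed.

Let kvg_growth : cgrowth 1 (fun k => k%:C * vg k).
Proof. by apply: eq_cgrowth (@g_growth 1 isT isT) => k k0; rewrite mul_vg. Qed.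

Let u0 := claplace mu (fun k => k%:C * g k).
Let w0 := claplace mu vg.
Let u0_L2 : L2 u0. Proof. exact: (L2_claplace_mu mu_cofinite kg_growth). Qed.
Let w0_L2 : L2 w0. Proof. exact: (L2_claplace_mu mu_cofinite (@vg_growth 1 isT isT)). Qed.

(* The derivative of an eigenvector solves the first resolvent equation, and
   its primitive the second one, up to a constant. *)
Let T_u0 t : 0 < t -> T u0 t = cint mu Rpos g * hmuC mu t.
Proof.
move=> t0; rewrite /add_scalar /u0.
rewrite (@Hankel_raise _ _ mu_cofinite g 0 (- E%:C) t (@g_growth 0 isT isT) (@g_growth 1 isT isT) kg_growth _ t0).
  by ring.
by move=> l l0; rewrite (laplace_g l0); ring.
Qed.

Let T_w0 t : 0 < t -> T w0 t = cint mu Rpos vg * hmu_intC mu t.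
Proof.
move=> t0; rewrite /add_scalar /w0.
rewrite (@Hankel_lower _ _ mu_cofinite vg 0 (- E%:C) t (@vg_growth 0 isT isT) (@vg_growth 1 isT isT) kvg_growth _ t0).
  by ring.
move=> l l0; rewrite (funext (eq_claplace mu mul_vg)) (laplace_g l0) (mul_vg l0).
by ring.
Qed.

(* If the constant vanished, u0 = 0 by injectivity, and then the shift identity
   would give g = 0. *)
Let cint_g_neq0 : cint mu Rpos g != 0.
Proof.
apply/negP => /eqP c0; apply: g_nonzero => k k0.
have u00 : aeq u0 (cst 0).
  apply: (add_scalar_pos_injective u0_L2).
  by apply: aeq_Rpos => t t0; rewrite (T_u0 t0) c0 mul0r.
have := claplace_shift mu_cofinite k0 (@g_growth 0 isT isT) (@g_growth 1 isT isT) kg_growth.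
rewrite (claplace_leb_ae0 u0_L2 u00 k0) c0 sub0r (laplace_g k0) => /esym/eqP.
by rewrite oppr_eq0 !mulf_eq0 (negbTE EC0) (negbTE (realC_neq0 k0)) /= => /eqP.
Qed.

Let cint_vg_neq0 : cint mu Rpos vg != 0.
Proof.
apply/negP => /eqP c0; apply: g_nonzero => k k0.
have w00 : aeq w0 (cst 0).
  apply: (add_scalar_pos_injective w0_L2).
  by apply: aeq_Rpos => t t0; rewrite (T_w0 t0) c0 mul0r.
have := claplace_shift mu_cofinite k0 (@vg_growth 0 isT isT) (@vg_growth 1 isT isT) kvg_growth.
rewrite (claplace_leb_ae0 w0_L2 w00 k0) c0 mulr0 subrr.
rewrite (funext (eq_claplace mu mul_vg)) (laplace_g k0) => /eqP.
by rewrite mulf_eq0 (negbTE EC0) /= => /eqP.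
Qed.

Lemma phi_collinear : exists c : R[i], aeq (phi mu E%:C) (fun t => c * psi t).
Proof.
set u := op_inv T (hmuC mu).
pose c := (cint mu Rpos g)^-1.
have sol : L2 (fun t => c * u0 t + 0 * u0 t) /\
    aeq (T (fun t => c * u0 t + 0 * u0 t)) (hmuC mu).
  split; first exact: L2_lin.
  apply: aeq_Rpos => t t0; rewrite /add_scalar Hankel_lin//.
  have := T_u0 t0; rewrite /add_scalar => e.
  by rewrite !mul0r !addr0 mulrCA -mulrDr e mulKf.
have [u2 Tu] := op_invP (ex_intro _ _ sol).
have ua : aeq u (claplace mu (fun k => c * (k%:C * g k))).
  apply: aeq_trans (add_scalar_pos_unique u2 sol.1 Tu sol.2) _.
  apply: aeq_Rpos => t t0; rewrite mul0r addr0 claplace_muZ//.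
have g1 : cgrowth 1 (fun k => c * (k%:C * g k)) by exact: cgrowthZ.
have g2 : cgrowth 2 (fun k => c * (k%:C * g k)).
  by apply: cgrowthZ; exact: (cgrowth_mul (@g_growth 0 isT isT)).
exists (- c); apply: aeq_trans (_ : aeq _ (fun t => - c * claplace mu g t)) _.
  apply: aeq_Rpos => t t0; rewrite (phi_claplace mu_cofinite t0 g1 g2 u2 ua).
  rewrite mulNr -claplace_muZ//; last exact: g_growth.
  congr (- _); apply: eq_claplace => k k0.
  by rewrite mulrCA [(k^-1)%:C * _]mulrA [(k^-1)%:C * _]mulrC realC_mulV// mul1r.
by apply: filterS psi_ae => t h Rt; rewrite h.
Qed.

Lemma theta_collinear : exists c : R[i], aeq (theta mu E%:C) (fun t => c * psi t).
Proof.
set w := op_inv T (hmu_intC mu).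
pose c := (cint mu Rpos vg)^-1.
have sol : L2 (fun t => c * w0 t + 0 * w0 t) /\
    aeq (T (fun t => c * w0 t + 0 * w0 t)) (hmu_intC mu).
  split; first exact: L2_lin.
  apply: aeq_Rpos => t t0; rewrite /add_scalar Hankel_lin//.
  have := T_w0 t0; rewrite /add_scalar => e.
  by rewrite !mul0r !addr0 mulrCA -mulrDr e mulKf.
have [w2 Tw] := op_invP (ex_intro _ _ sol).
have g1 : cgrowth 1 (fun k => c * vg k) by apply: cgrowthZ; exact: vg_growth.
have g2 : cgrowth 1 (fun k => k%:C * (c * vg k)).
  apply: (@eq_cgrowth _ _ (fun k => c * g k)); last by apply: cgrowthZ; exact: g_growth.
  by move=> k k0; rewrite mulrCA (mul_vg k0).
have wa : aeq w (claplace mu (fun k => c * vg k)).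
  apply: aeq_trans (add_scalar_pos_unique w2 sol.1 Tw sol.2) _.
  by apply: aeq_Rpos => t t0; rewrite mul0r addr0 claplace_muZ//; exact: vg_growth.
exists (- c); apply: aeq_trans (_ : aeq _ (fun t => - c * claplace mu g t)) _.
  apply: aeq_Rpos => t t0; rewrite (theta_claplace mu_cofinite t0 g1 g2 wa).
  rewrite mulNr -claplace_muZ//; last exact: g_growth.
  congr (- _); apply: eq_claplace => k k0.
  by rewrite mulrCA (mul_vg k0).
by apply: filterS psi_ae => t h Rt; rewrite h.
Qed.

End positive_spectrum.

(** * Linear independence and rank one *)

Section independence.
Context {R : realType}.
Variable mu : {finite_measure set (measurableTypeR R) -> \bar R}.
Hypothesis mu_cofinite : cofinite_on_Rpos mu.
Local Notation leb := (@lebesgue_measure R).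

#[local] Instance ae_mu_filter : Filter (nbhs (almost_everywhere mu)).
Proof. exact: ae_filter_ringOfSetsType. Qed.

(** Only the values of L' L (p/k + q) at 1 and 2 are used, that is the integrals
    of (p/k + q) / (k + 1) and (p/k + q) / (k + 2). *)
Lemma laplace_affine_eq0 (p q : R) :
  {ae leb, forall t, Rpos t -> laplace mu (fun k => p * k^-1 + q) t = 0} ->
  {ae mu, forall k, Rpos k -> p + q * k = 0}.
Proof.
set v := (fun k => p * k^-1 + q) => v0.
have gv : growth 1 v.
  apply: growthD; last exact: growth_cst.
  apply: (@eq_growth _ _ (fun k => k^-1 * cst p k)); first by move=> k _; rewrite mulrC.
  by apply: growth_div; exact: growth_cst.
have zero l : 0 < l -> \int[mu]_(k in Rpos) (v k / (k + l)) = 0.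
  move=> l0; have [i _ <-] := laplace_laplace mu_cofinite l0 gv.
  rewrite {1}/laplace {1}/Rintegral (@ae_eq_integral _ _ _ _ _ (cst 0%E)) ?integral0//.
    exact: (measurable_int _ i).
  by apply: filterS v0 => t h Rt; rewrite /= h// mul0r.
have l1 : 0 < (1 : R) by [].
have l2 : 0 < (2 : R) by [].
have [_ i1 _] := laplace_laplace mu_cofinite l1 gv.
have [_ i2 _] := laplace_laplace mu_cofinite l2 gv.
(* Partial fractions: the two coefficients turn the combination into
   (p/k + q) (p + q k) / ((k + 1) (k + 2)), which has a sign. *)
pose n (k : R) := (p - q) * (v k / (k + 1)) + (2 * q - p) * (v k / (k + 2)).
have nE k : 0 < k -> n k = (p + q * k) ^+ 2 / (k * (k + 1) * (k + 2)).
  move=> k0; rewrite /n /v; field.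
  by rewrite !gt_eqF ?addr_gt0.
have In : mu.-integrable Rpos (EFin \o n) by exact: integrable_lin.
have n0 : \int[mu]_(k in Rpos) n k = 0.
  by rewrite Rintegral_lin// !zero// !mulr0 addr0.
have n_ge0 k : 0 < k -> 0 <= n k.
  by move=> k0; rewrite nE// divr_ge0 ?sqr_ge0// !mulr_ge0// ?addr_ge0// ltW.
have : (\int[mu]_(k in Rpos) `|(EFin \o n) k|)%E = 0%E.
  rewrite -[LHS]fineK; last first.
    by have := integrable_fin_num measurable_Rpos (integrable_abse In).
  rewrite -[X in _ = X]/((0 : R)%:E) -n0; congr EFin; congr fine.
  apply: eq_integral => k /set_mem; rewrite RposE => k0 /=.
  by rewrite ger0_norm// n_ge0.
move/(ae_eq_integral_abs mu measurable_Rpos (measurable_int _ In)).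
apply: filterS => k + Rk => /(_ Rk) /= [].
move: Rk; rewrite RposE => k0; rewrite nE// => /eqP.
rewrite mulf_eq0 invr_eq0 (gt_eqF (_ : 0 < k * (k + 1) * (k + 2))) ?orbF; last first.
  by rewrite !mulr_gt0// addr_gt0.
by rewrite sqrf_eq0 => /eqP.
Qed.

Lemma hmu_lin_laplace (p q t : R) : 0 < t ->
  p * hmu_int mu t + q * hmu mu t = laplace mu (fun k => p * k^-1 + q) t.
Proof.
move=> t0.
have gi : growth 1 (fun k : R => k^-1).
  apply: (@eq_growth _ _ (fun k => k^-1 * cst 1 k)); first by move=> k _; rewrite mulr1.
  by apply: growth_div; exact: growth_cst.
rewrite laplaceD//; [|exact: growthZ|exact: growth_cst].
rewrite laplaceZ//.
have /(congr1 (@complex.Re R)) /= -> := hmu_intC_claplace mu_cofinite (ltW t0).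
congr (_ + _).
have -> : laplace mu (fun=> q) t = q * laplace mu (cst 1) t.
  rewrite -laplaceZ//; first by apply: eq_laplace => k _; rewrite mulr1.
  exact: growth_cst.
by congr (_ * _); apply: eq_Rintegral => k _; rewrite mul1r.
Qed.

Hypothesis H_neq0 : exists2 f : R -> R[i], L2 f & ~ aeq (Hankel mu f) (cst 0).

Lemma laplace_ae_mu (a b : R -> R) t : 0 < t -> growth 1 a -> growth 1 b ->
  {ae mu, forall k, Rpos k -> a k = b k} -> laplace mu a t = laplace mu b t.
Proof.
move=> t0 ga gb ab; rewrite /laplace /Rintegral; congr fine.
apply: ae_eq_integral => //.
- exact: (measurable_int _ (growth1_laplace_integrable mu_cofinite t0 ga)).
- exact: (measurable_int _ (growth1_laplace_integrable mu_cofinite t0 gb)).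
- by apply: filterS ab => k h Rk; rewrite h.
Qed.

Lemma mu_Rpos_not_negligible : ~ {ae mu, forall k, Rpos k -> False}.
Proof.
move=> mu0; have [f f2] := H_neq0; apply.
have [g1 g2] : cgrowth 1 (claplace leb f) by exact: (cgrowth_claplace_leb mu_cofinite).
apply: aeq_Rpos => t t0; rewrite Hankel_claplace//.
rewrite -[RHS](claplace0 mu t); apply: complex_ext; apply: laplace_ae_mu => //;
  try exact: (@growth_cst R 1 0 isT isT); by apply: filterS mu0 => k h /h.
Qed.

Lemma affine_ae_eq0 (p q : R) :
  {ae mu, forall k, Rpos k -> p + q * k = 0} ->
  (p = 0 /\ q = 0) \/ {ae mu, forall k, Rpos k -> k = - p / q}.
Proof.
move=> pq; have [q0|q0] := eqVneq q 0; last first.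
  right; apply: filterS pq => k + Rk => /(_ Rk) /eqP.
  rewrite addrC addr_eq0 => /eqP e.
  by rewrite -e mulrC mulKf.
left; split => //; apply: contrapT => p0; apply: mu_Rpos_not_negligible.
by apply: filterS pq => k h Rk; apply: p0; have := h Rk; rewrite q0 mul0r addr0.
Qed.

Lemma hmuC_not_ae0 : ~ aeq (hmuC mu) (cst 0).
Proof.
move=> h0; apply: mu_Rpos_not_negligible.
have : {ae leb, forall t, Rpos t -> laplace mu (fun k => 0 * k^-1 + 1) t = 0}.
  apply: filterS h0 => t + Rt => /(_ Rt) /(congr1 (@complex.Re R)) /=.
  move: Rt; rewrite RposE => t0.
  by rewrite -hmu_lin_laplace// mul0r add0r mul1r.
move=> /laplace_affine_eq0; apply: filterS => k h Rk.
have := h Rk; rewrite add0r mul1r => k0.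
by move: Rk; rewrite RposE k0 ltxx.
Qed.

(** For a point mass at d, H f is e^{-td} times the integral of L' f. *)
Lemma point_mass_rank1 (d : R) : {ae mu, forall k, Rpos k -> k = d} ->
  has_rank (Hankel mu) 1.
Proof.
move=> mud.
have Hf f t : L2 f -> 0 < t -> Hankel mu f t = (expR (- (t * d)))%:C * cint mu Rpos (claplace leb f).
  move=> f2 t0; rewrite Hankel_claplace//.
  have gf : cgrowth 1 (claplace leb f) by exact: (cgrowth_claplace_leb mu_cofinite).
  have if0 : cintegrable mu Rpos (claplace leb f).
    exact: (cgrowth0_cintegrable mu_cofinite (cgrowth_claplace_leb mu_cofinite (n := 0) f2 isT isT)).
  have real (a : R -> R) : growth 1 a -> mu.-integrable Rpos (EFin \o a) ->
      laplace mu a t = expR (- (t * d)) * \int[mu]_(k in Rpos) a k.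
    move=> ga ia; rewrite mulrC -(RintegralZr _ measurable_Rpos ia).
    rewrite /laplace /Rintegral; congr fine.
    apply: ae_eq_integral => //.
    - exact: (measurable_int _ (growth1_laplace_integrable mu_cofinite t0 ga)).
    - by apply/measurable_EFinP; apply: measurable_funM => //; case: ga.
    - by apply: filterS mud => k h Rk; rewrite -(h Rk).
  apply: complex_ext.
  - by rewrite cReM /= oppr0 mul0r addr0 real//; [exact: gf.1|exact: if0.1].
  - by rewrite cImM /= mul0r addr0 real//; [exact: gf.2|exact: if0.2].
have [f f2 nf] := H_neq0.
have A0 : cint mu Rpos (claplace leb f) != 0.
  apply/negP => /eqP A0; apply: nf; apply: aeq_Rpos => t t0.
  by rewrite Hf// A0 mulr0.
exists (fun=> f); split => //.
- move=> c c0 i; rewrite (ord1 i); apply: contrapT => ci; apply: nf.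
  apply: filterS c0 => t + Rt => /(_ Rt); rewrite big_ord1 => /eqP.
  by rewrite mulf_eq0 => /orP[/eqP //|/eqP].
- move=> g g2; exists (fun=> cint mu Rpos (claplace leb g) / cint mu Rpos (claplace leb f)).
  apply: aeq_Rpos => t t0; rewrite big_ord1 !Hf// mulrCA; congr (_ * _).
  by rewrite divfK.
Qed.

Lemma hmu_int_indep (c0 c1 : R[i]) : ~ has_rank (Hankel mu) 1 ->
  aeq (fun t => c0 * hmu_intC mu t + c1 * hmuC mu t) (cst 0) -> c0 = 0 /\ c1 = 0.
Proof.
move=> nrank h.
have re : {ae leb, forall t, Rpos t ->
    laplace mu (fun k => complex.Re c0 * k^-1 + complex.Re c1) t = 0}.
  apply: filterS h => t + Rt => /(_ Rt) /(congr1 (@complex.Re R)).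
  move: Rt; rewrite RposE => t0.
  by rewrite cReD !cReM /= !mulr0 !addr0 hmu_lin_laplace.
have im : {ae leb, forall t, Rpos t ->
    laplace mu (fun k => complex.Im c0 * k^-1 + complex.Im c1) t = 0}.
  apply: filterS h => t + Rt => /(_ Rt) /(congr1 (@complex.Im R)).
  move: Rt; rewrite RposE => t0.
  by rewrite cImD !cImM /= !mulr0 !add0r hmu_lin_laplace.
have [[p0 q0]|/point_mass_rank1 //] := affine_ae_eq0 (laplace_affine_eq0 re).
have [[r0 s0]|/point_mass_rank1 //] := affine_ae_eq0 (laplace_affine_eq0 im).
by split; apply: complex_ext.
Qed.

End independence.

(** * The theorem for a finite measure *)

Section resolvent_set.
Context {R : realType}.
Variable mu : {finite_measure set (measurableTypeR R) -> \bar R}.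
Hypothesis mu_cofinite : cofinite_on_Rpos mu.
Variable E : R[i].
Hypothesis E_neq0 : E != 0.
Local Notation T := (add_scalar (Hankel mu) E).
Hypothesis T_inv : boundedly_invertible T.

Lemma hmuC_L2 : L2 (hmuC mu).
Proof.
rewrite (funext (hmuC_claplace mu)); apply: L2_claplace_mu => //.
exact: cgrowth_cst.
Qed.

Lemma hmu_intC_L2 : L2 (hmu_intC mu).
Proof.
apply: (@eq_L2 _ (claplace mu (fun k => (k^-1)%:C))).
  by move=> t t0; rewrite hmu_intC_claplace// ltW.
by apply: L2_claplace_mu => //; exact: cgrowth_inv.
Qed.

Lemma surj_solvable g : L2 g -> exists f, L2 f /\ aeq (T f) g.
Proof.
by have [_ [C surj]] := T_inv => /surj[f [f2 Tf _]]; exists f.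
Qed.

Let u := op_inv T (hmuC mu).
Let w := op_inv T (hmu_intC mu).

Let uP : L2 u /\ aeq (T u) (hmuC mu).
Proof. by apply: op_invP; apply: surj_solvable; exact: hmuC_L2. Qed.

Let wP : L2 w /\ aeq (T w) (hmu_intC mu).
Proof. by apply: op_invP; apply: surj_solvable; exact: hmu_intC_L2. Qed.

Lemma resolvent_identities :
  [/\ L2 (phi mu E), L2 (theta mu E),
      aeq (add_scalar (Hankel mu) (- E) (phi mu E))
          (fun t => Delta mu E * hmu_intC mu t) &
      aeq (add_scalar (Hankel mu) (- E) (theta mu E))
          (fun t => Delta mu E * hmuC mu t)].
Proof.
have [u2 Tu] := uP; have [w2 Tw] := wP.
have aE k := erefl (E^-1 * (1 - claplace lebesgue_measure u k)).
have bE k := erefl (E^-1 * ((k^-1)%:C - claplace lebesgue_measure w k)).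
split.
- exact: (phi_L2 mu_cofinite E_neq0 (erefl u) u2 Tu aE).
- exact: (theta_L2 mu_cofinite E_neq0 (erefl w) w2 Tw bE).
- by apply: aeq_Rpos => t t0; exact: (Hankel_phi mu_cofinite E_neq0 (erefl u) u2 Tu aE t0).
- by apply: aeq_Rpos => t t0; exact: (Hankel_theta mu_cofinite E_neq0 (erefl u) (erefl w)
    u2 w2 Tu Tw aE bE t0).
Qed.

Lemma resolvent_independence :
  (exists2 f : R -> R[i], L2 f & ~ aeq (Hankel mu f) (cst 0)) ->
  boundedly_invertible (add_scalar (Hankel mu) (- E)) ->
  ~ has_rank (Hankel mu) 1 ->
  lin_indep (tnth [tuple phi mu E; theta mu E]).
Proof.
move=> H_neq0 [inj _] nrank c.
have [u2 Tu] := uP; have [w2 Tw] := wP.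
have aE k := erefl (E^-1 * (1 - claplace lebesgue_measure u k)).
have [phi2 theta2 Hphi Htheta] := resolvent_identities.
have D0 : Delta mu E != 0.
  apply/negP => /eqP D0; apply: (hmuC_not_ae0 mu_cofinite H_neq0).
  apply: (phi_ae0_Delta0 mu_cofinite E_neq0 (erefl u) u2 Tu aE D0).
  apply: inj => //; apply: aeq_trans Hphi _.
  by apply: aeq_Rpos => t _; rewrite D0 mul0r.
move=> c0; pose F t := c ord0 * phi mu E t + c (lift ord0 ord0) * theta mu E t.
have F2 : L2 F by exact: L2_lin.
have F0 : aeq F (cst 0).
  apply: filterS c0 => t + Rt => /(_ Rt).
  by rewrite big_ord_recl big_ord1 !(tnth_nth 0).
have HF0 : aeq (add_scalar (Hankel mu) (- E) F) (cst 0).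
  have F0' := F0; apply: filterS F0' => t Ft Rt.
  rewrite /add_scalar (Ft Rt) mulr0 addr0; move: Rt; rewrite RposE => t0.
  rewrite Hankel_claplace// (@eq_claplace _ mu _ (cst 0)) ?claplace0// => k k0.
  exact: claplace_leb_ae0.
have [] : c ord0 = 0 /\ c (lift ord0 ord0) = 0.
  apply: (hmu_int_indep mu_cofinite H_neq0 nrank).
  apply: filterS3 HF0 Hphi Htheta => t h0 h1 h2 Rt.
  have := h0 Rt; have := h1 Rt; have := h2 Rt.
  move: Rt; rewrite RposE => t0; rewrite /add_scalar Hankel_lin// => e2 e1 e0.
  apply: (mulfI D0); rewrite mulr0 mulrDr !(mulrCA (Delta mu E)) -e1 -e2.
  by rewrite -[RHS]e0 /F; ring.
move=> z0 z1 i; case: (unliftP ord0 i) => [j ->|-> //].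
by rewrite (ord1 j).
Qed.

End resolvent_set.

Lemma hmu_eq {R : realType} (m1 m2 : borel_measure R) :
  (forall A : set (measurableTypeR R), measurable A -> A `<=` Rpos -> m1 A = m2 A) ->
  hmu m1 = hmu m2.
Proof.
move=> m12; apply/funext => t; rewrite /hmu /Rintegral; congr fine.
exact: eq_measure_integral.
Qed.

Theorem theorem8p4 (R : realType) (mu : borel_measure R)
    (mu_finite : finite_on_Rpos mu) (mu_cofinite : cofinite_on_Rpos mu)
    (H_neq0 : exists2 f : R -> R[i], L2 f & ~ aeq (Hankel mu f) (cst 0)) :
  [/\ (forall E : R[i], ~ spectrum (Hankel mu) (- E) ->
        [/\ L2 (phi mu E), L2 (theta mu E),
            aeq (add_scalar (Hankel mu) (- E) (phi mu E))
                (fun t => Delta mu E * hmu_intC mu t) &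
            aeq (add_scalar (Hankel mu) (- E) (theta mu E))
                (fun t => Delta mu E * hmuC mu t)]),
      (forall E : R, 0 < E ->
        forall psi : R -> R[i], eigenvector (Hankel mu) E%:C psi ->
          (exists c : R[i], aeq (phi mu E%:C) (fun t => c * psi t)) /\
          (exists c : R[i], aeq (theta mu E%:C) (fun t => c * psi t))) &
      (forall E : R[i], ~ spectrum (Hankel mu) (- E) ->
        ~ spectrum (Hankel mu) E -> ~ has_rank (Hankel mu) 1 ->
        lin_indep (tnth [tuple phi mu E; theta mu E]))].
Proof.
(* H, h, phi, theta and Delta only see mu on R_+, so mu may be replaced by its
   restriction to R_+, which is a finite measure. *)
pose nu : {finite_measure set (measurableTypeR R) -> \bar R} :=
  mfrestr measurable_Rpos mu_finite.
have munu (A : set (measurableTypeR R)) : measurable A -> A `<=` Rpos -> mu A = nu A.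
  by move=> _ AR; rewrite /nu /= /mfrestr /mrestr setIidl.
have hE : hmu mu = hmu nu by exact: hmu_eq.
have nu_cofinite : cofinite_on_Rpos nu.
  have e : (\int[mu]_(l in Rpos) (l ^- 2)%:E = \int[nu]_(l in Rpos) (l ^- 2)%:E)%E.
    exact: eq_measure_integral.
  by rewrite /cofinite_on_Rpos -e.
have hCE : hmuC mu = hmuC nu by rewrite /hmuC hE.
have hintE : hmu_int mu = hmu_int nu by rewrite /hmu_int hE.
have hintCE : hmu_intC mu = hmu_intC nu by rewrite /hmu_intC hintE.
have HE : Hankel mu = Hankel nu by rewrite /Hankel hCE.
have phiE : phi mu = phi nu by rewrite /phi HE hCE.
have thetaE : theta mu = theta nu by rewrite /theta HE hintCE.
have DeltaE : Delta mu = Delta nu by rewrite /Delta HE hCE hintCE hE.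
rewrite HE phiE thetaE DeltaE hCE hintCE in H_neq0 *.
have inv (E : R[i]) : ~ spectrum (Hankel nu) (- E) ->
    boundedly_invertible (add_scalar (Hankel nu) E).
  by move=> /contrapT; rewrite opprK.
split.
- move=> E /inv TE.
  exact: (resolvent_identities nu_cofinite (boundedly_invertible_neq0 nu_cofinite TE) TE).
- move=> E E0 psi psiE.
  have gE k := erefl ((E%:C)^-1 * claplace lebesgue_measure psi k).
  split; [exact: (phi_collinear nu_cofinite E0 psiE gE)|
          exact: (theta_collinear nu_cofinite E0 psiE gE)].
- move=> E /inv TE /contrapT TNE.
  exact: (resolvent_independence nu_cofinite (boundedly_invertible_neq0 nu_cofinite TE) TE).
Qed.
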